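(* If $\Phi:\mathbb R\to\mathbb R$ is a $2\pi$-periodic bounded function of the class $\mathcal{CBV}(\mathbb R)$, then $\mathbb U_{\Phi}(z)\to\Phi'(\arg\zeta)$ as $z\to\zeta$ for a.e. $\zeta\in\partial\mathbb D$ along all nontangential paths in $\mathbb D$ to the point $\zeta$.
   Context: $\mathbb D=\{z\in\mathbb C:|z|<1\}$; for $|\zeta|=1$, $\arg\zeta$ is the unique $\tau\in(-\pi,\pi]$ with $\zeta=e^{i\tau}$. A function $\Phi:\mathbb R\to\mathbb C$ is of countably bounded variation, written $\Phi\in\mathcal{CBV}(\mathbb R)$, if there is a countable collection of mutually disjoint intervals $(a_n,b_n)$, $n=1,2,\dots$, on each of which the restriction of $\Phi$ is of bounded variation and such that the set $\mathbb R\setminus\bigcup_{n=1}^\infty(a_n,b_n)$ is countable. For arbitrary functions $g,f$ on a compact interval $[a,b]$, the Riemann--Stieltjes integral $\int_a^b g\,df$ is the limit, as $\delta:=\max_k|t_k-t_{k-1}|\to0$, of the sums $\sum_{k=1}^p g(\tau_k)\,(f(t_k)-f(t_{k-1}))$ over partitions $a=t_0\le t_1\le\dots\le t_p=b$ and points $\tau_k\in[t_{k-1},t_k]$, provided a finite limit exists, uniform with respect to the partitions and the intermediate points (no monotonicity or bounded variation is assumed). The Poisson kernel is $P_r(\Theta)=\dfrac{1-r^2}{1-2r\cos\Theta+r^2}$, $0\le r<1$. For a $2\pi$-periodic bounded $\Phi:\mathbb R\to\mathbb R$ whose set of discontinuities has measure zero, the Poisson--Stieltjes integral is the Riemann--Stieltjes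 integral $$\mathbb U_\Phi(z):=\frac1{2\pi}\int_{-\pi}^{\pi}P_r(\vartheta-t)\,d\Phi(t),\qquad z=re^{i\vartheta},\ r<1.$$ A path in $\mathbb D$ terminating at $\zeta\in\partial\mathbb D$ is nontangential if its part in a neighborhood of $\zeta$ lies inside an angle in $\mathbb D$ with vertex at $\zeta$. *)

(* Defs.v *)
From HB Require Import structures.
From mathcomp Require Import all_boot all_order all_algebra.
From mathcomp Require Import all_classical all_reals all_analysis.
From mathcomp Require Import complex.

Set Implicit Arguments.
Unset Strict Implicit.
Unset Printing Implicit Defensive.

Import Order.TTheory GRing.Theory Num.Theory.
Import numFieldNormedType.Exports.
Import ComplexField.Normc.

Local Open Scope classical_set_scope.
Local Open Scope ring_scope.
Local Open Scope complex_scope.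

Section Circle.
Context {R : realType}.
Implicit Types (z zeta : R[i]) (t : R).

Definition unit_disc : set R[i] := [set z | normc z < 1].

Definition expi t : R[i] := cos t +i* sin t.

(* For z = 0 every t in ]-pi, pi] qualifies and the value is an arbitrary one
   of them. *)
Definition carg z : R :=
  xget 0 [set t | - pi < t <= pi /\ z = (normc z)%:C * expi t].

(* Almost everywhere on the unit circle with respect to arc length, the image
   of Lebesgue measure on ]-pi, pi] under expi. *)
Definition ae_circle (P : R[i] -> Prop) : Prop :=
  {ae @lebesgue_measure R, forall t, - pi < t <= pi -> P (expi t)}.

End Circle.

Section CountablyBoundedVariation.
Context {R : realType}.
Implicit Types (Phi : R -> R) (a b : R).

Definition bounded_variation_oo a b Phi : Prop :=
  exists M : R, forall c d, a < c -> c <= d -> d < b ->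
    (total_variation c d Phi <= M%:E)%E.

Definition CBV Phi : Prop :=
  exists a b : nat -> R,
  [/\ forall n, a n < b n,
      trivIset setT (fun n => `]a n, b n[%classic),
      forall n, bounded_variation_oo (a n) (b n) Phi
    & countable (~` \bigcup_n `]a n, b n[%classic)].

End CountablyBoundedVariation.

Section RiemannStieltjes.
Context {R : realType}.
Implicit Types (g f : R -> R) (a b : R).

(* Only the values t 0, ..., t p and tau 0, ..., tau (p - 1) matter;
   tau k lies in [t k, t (k + 1)]. *)
Definition is_RS_integral g f a b (I : R) : Prop :=
  forall eps : R, 0 < eps -> exists2 delta : R, 0 < delta &
  forall (p : nat) (t tau : nat -> R),
    t 0%N = a -> t p = b ->
    (forall k, (k < p)%N ->
      [/\ t k <= t k.+1, t k.+1 - t k < delta & t k <= tau k <= t k.+1]) ->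
    `|\sum_(0 <= k < p) g (tau k) * (f (t k.+1) - f (t k)) - I| < eps.

Definition RS_integrable g f a b : Prop := exists I, is_RS_integral g f a b I.

(* Meaningful only when RS_integrable g f a b; it is 0 otherwise. *)
Definition RS_integral g f a b : R := xget 0 [set I | is_RS_integral g f a b I].

End RiemannStieltjes.

Section PoissonStieltjes.
Context {R : realType}.
Implicit Types (Phi : R -> R) (z : R[i]).

Definition poisson_kernel (r theta : R) : R :=
  (1 - r ^+ 2) / (1 - 2 * r * cos theta + r ^+ 2).

(* The choice of carg 0 is immaterial since poisson_kernel 0 is constant. *)
Definition poisson_at z (t : R) : R := poisson_kernel (normc z) (carg z - t).

Definition poisson_stieltjes Phi z : R :=
  (2 * pi)^-1 * RS_integral (poisson_at z) Phi (- pi) pi.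

End PoissonStieltjes.

Section NontangentialPaths.
Context {R : realType}.
Implicit Types (z zeta : R[i]) (gamma : R -> R[i]).

Definition angle zeta (alpha beta : R) : set R[i] :=
  [set z | exists s theta : R,
    [/\ 0 < s, alpha < theta < beta & z = zeta + s%:C * expi theta]].

Definition path_to zeta gamma : Prop :=
  [/\ {within `[0, 1], continuous (gamma : R -> R[i]^o)},
      forall s : R, 0 <= s < 1 -> unit_disc (gamma s)
    & gamma 1 = zeta].

(* The angle is an unbounded sector, so lying in the disc is required only
   near its vertex. This forces both sides of the angle to be transversal to
   the circle: an open sector with a side tangent to the circle leaves the
   disc arbitrarily close to the vertex. *)
Definition nontangential zeta gamma : Prop :=
  exists alpha beta rho : R,
  [/\ alpha < beta, 0 < rho,
      forall z, angle zeta alpha beta z -> normc (z - zeta) < rho ->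
        unit_disc z
    & forall s : R, 0 <= s < 1 -> normc (gamma s - zeta) < rho ->
        angle zeta alpha beta (gamma s)].

End NontangentialPaths.

(* Main.v *)
(* A function of bounded variation is differentiable almost everywhere
   (Lebesgue); the proof is D. Austin's covering argument.  If the slopes of g
   at every point of E are frequently below -alpha and frequently above alpha,
   take a partition whose variation nearly exhausts the total variation.  On
   each cell, total variation minus the signed increment of g is a
   nondecreasing function with small total increase which is steep near every
   point of E, so Vitali's covering lemma bounds the outer measure of E in that
   cell.

   Summation by parts turns the sums of the Poisson-Stieltjes integral into
   sums of Phi against the differentiable kernel.  They converge because Phi is
   continuous almost everywhere.

   For the boundary behaviour subtract from Phi its first-order Taylor
   polynomial at t0: the kernel integrates to 1, and since the remainder is
   o(t - t0), the same summation by parts bounds its contribution, cell by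
   cell, by increments of a small multiple of atan ((s - theta) / (1 - r)),
   provided that theta - t0 = O(1 - r), which is the nontangential condition. *)

Require Import Defs.
From mathcomp Require Import all_boot all_order all_algebra.
From mathcomp Require Import all_classical all_reals all_analysis.
From mathcomp Require Import complex.
From mathcomp Require Import measurable_realfun ring lra.

Set Implicit Arguments.
Unset Strict Implicit.
Unset Printing Implicit Defensive.

Import Order.TTheory GRing.Theory Num.Theory.
Import numFieldNormedType.Exports.

Local Open Scope classical_set_scope.
Local Open Scope ring_scope.

(** * Differentiability of functions of bounded variation *)

Section LebesgueDifferentiation.
Context {R : realType}.
Implicit Types (f g N : R -> R) (a b x y u v : R) (E : set R).

Let outer E : \bar R := ((@wlength R idfun)^* E)%mu.

(** Vitali's lemma selects disjoint balls centred in [E], with the lengths of the steep intervals as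
    radii, whose 5-fold enlargements cover [E]. An enlarged ball has measure 10 times the length of
    its interval, hence at most [10 / lam] times the increase of [N] there; the intervals being
    disjoint and [N] monotone, these increases add up to at most [N b - N a]. *)
Lemma outer_measure_steep a b lam N E :
  0 < lam -> a <= b ->
  (forall x y, a <= x -> x <= y -> y <= b -> N x <= N y) ->
  (forall x, E x -> exists uv : R * R,
     [/\ a <= uv.1, uv.1 < uv.2, uv.2 <= b, uv.1 = x \/ uv.2 = x
       & lam * (uv.2 - uv.1) <= N uv.2 - N uv.1]) ->
  (outer E <= (10 / lam * (N b - N a))%:E)%E.
Proof.
move=> lam0 ab ndN steep.
pose P x (uv : R * R) := [/\ a <= uv.1, uv.1 < uv.2, uv.2 <= b,
  uv.1 = x \/ uv.2 = x & lam * (uv.2 - uv.1) <= N uv.2 - N uv.1].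
(* The default [(0, 1)] keeps the radii positive at points outside [E] too. *)
pose w x := xget (0, 1) [set uv | P x uv].
have wP x : E x -> P x (w x).
  by move=> Ex; rewrite /w; case: xgetP => // /(_ _) H; have [uv /H] := steep x Ex.
have w_gt0 x : 0 < (w x).2 - (w x).1.
  rewrite subr_gt0 /w; case: xgetP => [uv _ []//|_ /=]; exact: ltr01.
pose B x := ball x ((w x).2 - (w x).1).
have rB x : (radius (B x))%:num = (w x).2 - (w x).1.
  by rewrite radius_ball_num// ltW.
have clB x y : closure (B x) y <-> `|x - y| <= (w x).2 - (w x).1.
  by rewrite /B closure_ballE closed_ballE.
have [||x Ex|D [cD DE tD cov]] :=
    @vitali_lemma_infinite_cover R R B E (b - a).
- by move=> x; exact: is_ball_ball.
- by move=> x; rewrite rB.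
- by rewrite rB; have [] := wP x Ex; lra.
have /countable_bijP[Z] := cD; rewrite card_eq_sym => /card_set_bijP[g [gD ginj gsurj]].
(* [g] enumerates the selected centres over [Z]; the other indices contribute empty sets. *)
pose F n := if n \in Z then closure (5%:R *` B (g n)) else set0.
pose G n := if n \in Z then `]N (w (g n)).1, N (w (g n)).2[%classic else set0.
have mG n : measurable (G n) by rewrite /G; case: ifP.
have EF : E `<=` \bigcup_n F n.
  move=> x Ex; have [|y Dy clxy] := cov x.
    by exists x => //=; apply/clB; rewrite subrr normr0 ltW.
  have [n Zn gn] := gsurj y Dy; exists n => //.
  by rewrite /F (mem_set Zn) gn; exact: clxy.
have FG n : (outer (F n) <= (10 / lam)%:E * lebesgue_measure (G n))%E.
  rewrite /F /G; case: ifPn => [/set_mem Zn|_]; last first.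
    by rewrite /outer outer_measure0 measure0 mule0.
  have [au uv vb _ Nuv] := wP _ (DE _ (gD _ Zn)).
  rewrite scale_ballE// closure_ballE.
  rewrite -[X in (X <= _)%E]/(lebesgue_measure _) lebesgue_measure_closed_ball; last first.
    by rewrite mulr_ge0// ltW.
  rewrite lebesgue_measure_itv/= lte_fin ifT; last first.
    by rewrite -subr_gt0 (lt_le_trans _ Nuv)// mulr_gt0// subr_gt0.
  have : (w (g n)).2 - (w (g n)).1 <= (N (w (g n)).2 - N (w (g n)).1) / lam.
    by rewrite ler_pdivlMr// mulrC.
  rewrite -EFinB -EFinM lee_fin -mulrA (mulrC lam^-1).
  set r := _ - _; set q := _ / _; rewrite mulr2n; lra.
have tG : trivIset setT G.
  apply/trivIsetP => n m _ _ nm; apply/eqP/negPn/negP => /set0P[t].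
  rewrite /G; case: ifPn => [/set_mem Zn|_ []//].
  case: ifPn => [/set_mem Zm|_ []//].
  rewrite /= !in_itv/= => -[/andP[N1t tN1] /andP[N2t tN2]].
  have Dn := gD _ Zn; have Dm := gD _ Zm.
  have [au uv vb x1 Nuv] := wP _ (DE _ Dn).
  have [au' uv' vb' x2 Nuv'] := wP _ (DE _ Dm).
  (* If two image intervals meet, monotonicity of [N] makes the two steep intervals overlap; the
     larger of their left endpoints then lies in both closed balls, against disjointness. *)
  have lt1 : (w (g n)).1 < (w (g m)).2.
    rewrite ltNge; apply/negP => /(ndN _ _ (ltW (le_lt_trans au' uv'))) H.
    by have := H (le_trans (ltW uv) vb); lra.
  have lt2 : (w (g m)).1 < (w (g n)).2.
    rewrite ltNge; apply/negP => /(ndN _ _ (ltW (le_lt_trans au uv))) H.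
    by have := H (le_trans (ltW uv') vb'); lra.
  move/trivIsetP : tD => /(_ (g n) (g m) Dn Dm) /=.
  have gnm : g n != g m.
    by apply: contra nm => /eqP/ginj => H; apply/eqP/H; rewrite inE.
  move=> /(_ gnm)/eqP; apply/negP/set0P.
  exists (Num.max (w (g n)).1 (w (g m)).1); split; apply/clB.
    have [l12|l12] := leP (w (g n)).1 (w (g m)).1.
      by clear - x1 uv uv' lt1 lt2 l12; case: x1 => x1; rewrite ler_norml; lra.
    by clear - x1 uv uv' lt1 lt2 l12; case: x1 => x1; rewrite ler_norml; lra.
  have [l12|l12] := leP (w (g n)).1 (w (g m)).1.
    by clear - x2 uv uv' lt1 lt2 l12; case: x2 => x2; rewrite ler_norml; lra.
  by clear - x2 uv uv' lt1 lt2 l12; case: x2 => x2; rewrite ler_norml; lra.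
have GN : \bigcup_n G n `<=` `[N a, N b]%classic.
  move=> t [n _]; rewrite /G; case: ifPn => [/set_mem Zn|_ []//].
  have [au uv vb _ _] := wP _ (DE _ (gD _ Zn)).
  rewrite /= !in_itv/= => /andP[ut tv]; apply/andP; split.
    by apply: le_trans (ltW ut); apply: ndN => //; lra.
  by apply: le_trans (ltW tv) _; apply: ndN => //; lra.
apply: (@le_trans _ _ (outer (\bigcup_n F n))); first exact: le_outer_measure.
apply: (le_trans (outer_measure_sigma_subadditive _ _)).
apply: (@le_trans _ _ (\sum_(0 <= n <oo) (10 / lam)%:E * lebesgue_measure (G n))%E).
  by apply: lee_nneseries => // n _; exact: outer_measure_ge0.
rewrite nneseriesZl; last by move=> n _; exact: measure_ge0.
have -> : (\sum_(0 <= n <oo) lebesgue_measure (G n) = lebesgue_measure (\bigcup_n G n))%E.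
  rewrite measure_semi_bigcup; [by []|exact: mG|exact: tG|].
  by apply: bigcup_measurable => n _; exact: mG.
rewrite [leRHS]EFinM; apply: lee_pmul => //; first by rewrite lee_fin divr_ge0// ltW.
apply: (@le_trans _ _ (lebesgue_measure `[N a, N b]%classic)).
  by apply: le_measure; rewrite ?inE//; apply: bigcup_measurable => n _; exact: mG.
rewrite lebesgue_measure_itv/=; case: ifPn => [_|_]; first by rewrite -EFinB.
by rewrite lee_fin subr_ge0; exact: ndN.
Qed.

Let fine_TV_D f a b x y z : bounded_variation a b f -> a <= x -> x <= y ->
  y <= z -> z <= b ->
  fine (total_variation x z f) =
  fine (total_variation x y f) + fine (total_variation y z f).
Proof.
move=> bv ax xy yz zb.
have xz := le_trans xy yz.
have bvxb := bounded_variationr ax (le_trans xz zb) bv.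
have bvxz := bounded_variationl xz zb bvxb.
rewrite (total_variationD f xy yz) fineD//; apply/bounded_variationP => //.
- exact: bounded_variationl xy yz bvxz.
- exact: bounded_variationr xy yz bvxz.
Qed.

Let fine_TV_ge f a b x y : bounded_variation a b f -> a <= x -> x <= y ->
  y <= b -> `|f y - f x| <= fine (total_variation x y f).
Proof.
move=> bv ax xy yb; rewrite -lee_fin fineK; first exact: total_variation_ge.
apply/bounded_variationP => //.
exact: bounded_variationl xy yb (bounded_variationr ax (le_trans xy yb) bv).
Qed.

(** Stands in for bounds on Dini derivates: left and right difference quotients at [x] are treated
    alike. *)
Definition frequent_slope f x (Q : R -> Prop) : Prop :=
  forall e, 0 < e -> exists u v,
    [/\ u < v, v - u < e, u = x \/ v = x & Q ((f v - f u) / (v - u))].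

Let frequent_slope_itv f x Q a b : a < x -> x < b -> frequent_slope f x Q ->
  exists uv : R * R, [/\ a <= uv.1, uv.1 < uv.2, uv.2 <= b, uv.1 = x \/ uv.2 = x
    & Q ((f uv.2 - f uv.1) / (uv.2 - uv.1))].
Proof.
move=> ax xb /(_ (Num.min (x - a) (b - x))).
rewrite lt_min !subr_gt0 ax xb => /(_ isT)[u [v [uv]]].
rewrite lt_min => /andP[d1 d2] uvx Quv.
by exists (u, v) => /=; split => //; case: uvx => ?; lra.
Qed.

(** The sign [sg] orients [g] so that its increment over the cell is nonnegative. Then [N], total
    variation minus oriented increment, is nondecreasing and rises with slope at least [al] wherever
    the oriented slope is below [- al]. *)
Let steep_cell g a b x y al E : bounded_variation a b g -> a <= x -> x <= y ->
  y <= b -> 0 < al ->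
  (forall z, E z -> frequent_slope g z (fun q => q < - al)) ->
  (forall z, E z -> frequent_slope g z (fun q => al < q)) ->
  (outer (E `&` `]x, y[) <=
   (10 / al * (fine (total_variation x y g) - `|g y - g x|))%:E)%E.
Proof.
move=> bv ax xy yb al0 Elo Ehi.
have [sg [sgE sg1 Esg]] : exists sg : R, [/\ sg * (g y - g x) = `|g y - g x|,
    (sg = 1 \/ sg = -1) &
    forall z, E z -> frequent_slope g z (fun q => sg * q < - al)].
  have [gxy|gxy] := leP 0 (g y - g x).
    exists 1; split; [by rewrite mul1r ger0_norm|by left|].
    move=> z /Elo H e /H[u [v [? ? ? ?]]]; exists u, v; split => //.
    by rewrite mul1r.
  exists (-1); split; [by rewrite mulN1r ltr0_norm|by right|].
  move=> z /Ehi H e /H[u [v [? ? ? ?]]]; exists u, v; split => //.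
  by rewrite mulN1r ltrN2.
pose N t := fine (total_variation x t g) - sg * (g t - g x).
have NB u v : x <= u -> u <= v -> v <= y ->
    N v - N u = fine (total_variation u v g) - sg * (g v - g u).
  move=> xu uv vy; rewrite /N (fine_TV_D bv ax xu uv (le_trans vy yb)).
  ring.
have TVge u v : x <= u -> u <= v -> v <= y ->
    `|g v - g u| <= fine (total_variation u v g).
  move=> xu uv vy.
  exact: fine_TV_ge bv (le_trans ax xu) uv (le_trans vy yb).
have le_sg r : sg * r <= `|r|.
  by case: sg1 => ->; rewrite ?mul1r ?mulN1r ?ler_norm// -normrN ler_norm.
have -> : fine (total_variation x y g) - `|g y - g x| = N y - N x.
  by rewrite NB// sgE.
apply: outer_measure_steep => //.
- move=> u v xu uv vy; rewrite -subr_ge0 NB// subr_ge0.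
  exact: le_trans (le_sg _) (TVge _ _ xu uv vy).
- move=> z [Ez]; rewrite /= in_itv/= => /andP[xz zy].
  have [[u v] /= [xu uv vy uvz Quv]] := frequent_slope_itv xz zy (Esg z Ez).
  exists (u, v); split => //=.
  rewrite NB//; last exact: ltW.
  have := TVge u v xu (ltW uv) vy.
  have : 0 <= `|g v - g u| by [].
  move: Quv; rewrite mulrA ltr_pdivrMr ?subr_gt0//; lra.
Qed.

(** Summing the bounds of [steep_cell] over a partition leaves [10 / al] times the gap between the
    total variation and the variation along the partition, and this gap can be made arbitrarily
    small. *)
Lemma opposite_slopes_null g a b al E : bounded_variation a b g -> a <= b ->
  0 < al -> E `<=` `]a, b[%classic ->
  (forall z, E z -> frequent_slope g z (fun q => q < - al)) ->
  (forall z, E z -> frequent_slope g z (fun q => al < q)) ->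
  outer E = 0%E.
Proof.
move=> bv ab al0 Eab Elo Ehi.
have cells s x : a <= x -> itv_partition x b s ->
    (outer (E `&` `]x, b[) <=
     (10 / al * (fine (total_variation x b g) - variation x b g s))%:E)%E.
  elim: s x => [x ax /itv_partition_nil ->|y s IH x ax xs].
    rewrite set_itvoo0 setI0 /outer outer_measure0 lee_fin.
    by rewrite total_variationxx variation_nil subrr mulr0.
  have xy : x < y by move: xs => [/= /andP[]].
  have ys := itv_partition_cons xs.
  have yb := itv_partition_le ys.
  rewrite (fine_TV_D bv ax (ltW xy) yb (lexx b)).
  rewrite -[y :: s]/([:: y] ++ s) (variation_cat _ (ltW xy) yb)//; last first.
    exact: itv_partition1.
  have -> : variation x y g [:: y] = `|g y - g x|.
    by rewrite /variation/= big_nat_recr//= big_nil add0r.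
  have H1 := steep_cell bv ax (ltW xy) yb al0 Elo Ehi.
  have H2 := IH y (le_trans ax (ltW xy)) ys.
  (* The partition point [y] lies in neither open piece and has measure zero. *)
  apply: (@le_trans _ _ (outer (E `&` `]x, y[) + (outer [set y] +
      outer (E `&` `]y, b[)))%E).
    apply: (@le_trans _ _ (outer ((E `&` `]x, y[) `|`
        ([set y] `|` (E `&` `]y, b[))))).
      apply: le_outer_measure.
      move=> z [Ez]; rewrite /= !in_itv/= => /andP[xz zb].
      have [zy|yz|->] := ltgtP z y; [left|right; right|right; left] => //.
        by rewrite xz.
    apply: (le_trans (outer_measureU2 _ _ _)); apply: leeD => //.
    exact: outer_measureU2.
  have -> : outer [set y] = 0%E by exact: lebesgue_measure_set1.
  rewrite add0e; apply: (le_trans (leeD H1 H2)).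
  by rewrite -EFinD lee_fin -mulrDr; apply: ler_wpM2l;
    [rewrite divr_ge0// ltW|lra].
apply/eqP; rewrite eq_le outer_measure_ge0 andbT.
apply/lee_addgt0Pr => e e0; rewrite add0e.
have TVfin : total_variation a b g \is a fin_num by apply/bounded_variationP.
(* The factor [10 / al] turns this gap into [e]. *)
have e0' : 0 < e * al / 10 by rewrite divr_gt0// mulr_gt0.
have [_ [_ [s abs <-] <-]] := ub_ereal_sup_adherent e0' TVfin.
rewrite -/(total_variation a b g) -(fineK TVfin) -EFinB lte_fin => sTV.
rewrite -(setIidl Eab); apply: (le_trans (cells s a (lexx a) abs)).
rewrite lee_fin -(ler_pM2l (_ : 0 < al / 10)) ?divr_gt0//.
rewrite mulrA (_ : al / 10 * (10 / al) = 1); last by field; rewrite gt_eqF.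
rewrite mul1r mulrC mulrA; lra.
Qed.

Lemma frequent_slope_impl f x (P Q : R -> Prop) :
  (forall q, P q -> Q q) -> frequent_slope f x P -> frequent_slope f x Q.
Proof.
by move=> PQ H e /H[u [v [? ? ? /PQ ?]]]; exists u, v.
Qed.

Lemma not_frequent_slope f x (Q : R -> Prop) : ~ frequent_slope f x Q ->
  exists2 e, 0 < e & forall u v, u < v -> v - u < e -> u = x \/ v = x ->
    ~ Q ((f v - f u) / (v - u)).
Proof.
move=> /existsNP[e /not_implyP[e0 H]]; exists e => // u v uv uve uvx Quv.
by apply: H; exists u, v.
Qed.

(** By contraposition: bounded slopes have a finite upper limit [L]. If they were also frequently
    below [L - eps], some rational would separate the low slopes from the high ones with room
    [k.+1%:R^-1]. Hence all slopes tend to [L]. *)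
Lemma not_derivable_slopes f x : ~ derivable f x 1 ->
  (forall n : nat, frequent_slope f x (fun q => n%:R < `|q|)) \/
  exists (c : rat) (k : nat),
    frequent_slope f x (fun q => q < ratr c - k.+1%:R^-1) /\
    frequent_slope f x (fun q => ratr c + k.+1%:R^-1 < q).
Proof.
apply: contra_notP => /not_orP[/existsNP[n /not_frequent_slope[e0 e0_gt0 He0]] Hck].
(* The supremum [L] of this set is the upper limit of all difference quotients at [x], the candidate
   derivative. *)
pose A := [set m | frequent_slope f x (fun q => m < q)].
have A0 : A (- n%:R - 1).
  move=> e e_gt0; exists x, (x + Num.min e e0 / 2).
  have m0 : 0 < Num.min e e0 by rewrite lt_min e_gt0.
  have me : Num.min e e0 <= e by rewrite ge_min lexx.
  have me0 : Num.min e e0 <= e0 by rewrite ge_min lexx orbT.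
  have H := He0 x (x + Num.min e e0 / 2).
  split; [lra|lra|by left|].
  move: H => /(_ ltac:(lra) ltac:(lra) ltac:(by left)) /negP.
  by rewrite -leNgt ler_norml => /andP[? _]; lra.
have Aub : ubound A n%:R.
  move=> m Am; have [u [v [uv uve0 uvx mq]]] := Am e0 e0_gt0.
  have /negP := He0 u v uv uve0 uvx.
  by rewrite -leNgt ler_norml => /andP[_ ?]; lra.
have supA : has_sup A by split; [exists (- n%:R - 1)|exists n%:R].
set L := sup A.
have slopes eps : 0 < eps -> exists2 e, 0 < e & forall u v, u < v -> v - u < e ->
    u = x \/ v = x -> `|(f v - f u) / (v - u) - L| <= eps.
  move=> eps0.
  have /not_frequent_slope[e1 e1_gt0 He1] :
      ~ frequent_slope f x (fun q => L + eps < q).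
    by move=> /(ub_le_sup (proj2 supA)); rewrite -/L; lra.
  have /not_frequent_slope[e2 e2_gt0 He2] :
      ~ frequent_slope f x (fun q => q < L - eps).
    move=> lo; apply: Hck.
    (* With [c] in the middle third of [[L - eps, L]] and [d < eps / 3], both [c - d] and [c + d]
       stay inside that interval. *)
    have [c /itvP cI] := @rat_in_itvoo R (L - eps / 3 * 2) (L - eps / 3) (ltac:(lra)).
    have c1 : L - eps / 3 * 2 < ratr c by rewrite cI.
    have c2 : ratr c < L - eps / 3 by rewrite cI.
    have [k [d [dE d_eps]]] : exists k d, d = k.+1%:R^-1 /\ d < eps / 3.
      have e3 : 0 < eps / 3 by lra.
      have [k _ /(_ k (leqnn k)) keps] := near_infty_natSinv_lt (PosNum e3).
      by exists k, k.+1%:R^-1.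
    have gap : 0 < L - (ratr c + d) by lra.
    have [m Am cm] := sup_adherent gap supA.
    exists c, k; rewrite -dE; split; first by apply: (frequent_slope_impl _ lo) => q; lra.
    apply: (frequent_slope_impl _ Am) => q; move: cm; rewrite -/L.
    by lra.
  exists (Num.min e1 e2); first by rewrite lt_min e1_gt0.
  move=> u v uv; rewrite lt_min => /andP[d1 d2] uvx.
  have /negP := He1 u v uv d1 uvx; have /negP := He2 u v uv d2 uvx.
  by rewrite -!leNgt ler_norml => ? ?; apply/andP; split; lra.
apply/cvg_ex; exists L; apply/cvgrPdist_le => eps eps0.
have [e e_gt0 He] := slopes eps eps0.
near=> h.
have h0 : h != 0 by near: h; exact: nbhs_dnbhs_neq.
have he : `|h| < e.
  by near: h; exact: dnbhs0_lt.
rewrite distrC /= -[h *: 1]/(h * 1) mulr1 -[_ *: _]/(_ * _) mulrC.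
have [h_lt0|h_gt0|/eqP] := ltgtP h 0; last by rewrite (negbTE h0).
- have -> : (f (h + x) - f x) / h = (f x - f (h + x)) / (x - (h + x)).
    by rewrite opprD addrCA subrr addr0 invrN mulrN -mulNr opprB.
  apply: He; [lra| |by right].
  by move: he; rewrite ltr0_norm//; lra.
- have -> : (f (h + x) - f x) / h = (f (h + x) - f x) / (h + x - x).
    by rewrite addrK.
  apply: He; [lra| |by left].
  by move: he; rewrite gtr0_norm//; lra.
Unshelve. all: end_near. Qed.

Let frequent_slope_add f c x (Q : R -> Prop) :
  frequent_slope f x (fun q => Q (q - c)) ->
  frequent_slope (f \+ (fun t => - c * t)) x Q.
Proof.
move=> H e /H[u [v [uv ? ? Quv]]]; exists u, v; split => //=.
suff -> : (f v + - c * v - (f u + - c * u)) / (v - u) = (f v - f u) / (v - u) - c.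
  by [].
by field; rewrite gt_eqF// subr_gt0.
Qed.

Let bounded_variation_linear a b c : a <= b ->
  bounded_variation a b (fun t => c * t).
Proof.
wlog c0 : c / 0 <= c => [H ab|ab].
  have [/H|c0] := leP 0 c; first exact.
  rewrite (_ : (fun t => c * t) = \- (fun t => - c * t)); last first.
    by apply/funext => t /=; rewrite mulNr opprK.
  by apply: bounded_variationN; apply: H => //; rewrite oppr_ge0 ltW.
apply: nondecreasing_bounded_variation => u v _ _ uv.
exact: ler_wpM2l.
Qed.

(** Where slopes of [f] are unbounded, its variation function is steep with every constant, so
    [outer_measure_steep] gives measure zero. Slopes oscillating around a rational [c] become
    opposite slopes of [f] minus [c * t]. Only countably many pairs [(c, k)] occur. *)
Theorem bounded_variation_derivable_ae f a b : bounded_variation a b f ->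
  (@lebesgue_measure R).-negligible
    [set x | `]a, b[%classic x /\ ~ derivable f x 1].
Proof.
move=> bv.
have [ba|ab] := leP b a.
  rewrite set_itv_ge ?bnd_simp -?leNgt//.
  by apply: negligibleS (negligible_set0 _) => x [].
pose I := [set x | `]a, b[%classic x /\
  forall n : nat, frequent_slope f x (fun q => n%:R < `|q|)].
pose O (c : rat) (k : nat) := [set x | `]a, b[%classic x /\
  (frequent_slope f x (fun q => q < ratr c - k.+1%:R^-1) /\
   frequent_slope f x (fun q => ratr c + k.+1%:R^-1 < q))].
pose O' n := if unpickle n is Some (c, k) then O c k else set0.
have sub : [set x | `]a, b[%classic x /\ ~ derivable f x 1] `<=`
    I `|` \bigcup_n O' n.
  move=> x [xab ndx].
  have sl := not_derivable_slopes ndx.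
  case: sl => [Ix|[c [k Ock]]].
  by left; split.
  right; exists (pickle (c, k)); first by [].
  by rewrite /O' pickleK; split.
have I0 : outer I = 0%E.
  pose V t := fine (total_variation a t f).
  have IV n : (outer I <= (10 / n.+1%:R * (V b - V a))%:E)%E.
    apply: outer_measure_steep => //; first exact: ltW.
      move=> x y ax xy yb.
      rewrite /V (fine_TV_D bv (lexx a) ax xy yb) lerDl.
      exact: le_trans (normr_ge0 _) (fine_TV_ge bv ax xy yb).
    move=> x [/=]; rewrite in_itv/= => /andP[ax xb] /(_ n.+1).
    move=> /(frequent_slope_itv ax xb)[[u v] /= [au uv vb uvx Quv]].
    exists (u, v); split => //=.
    rewrite /V (fine_TV_D bv (lexx a) au (ltW uv) vb) addrAC subrr add0r.
    apply: le_trans (fine_TV_ge bv au (ltW uv) vb).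
    move: Quv; rewrite normrM normfV ltr_pdivlMr ?normr_gt0 ?subr_eq0 ?gt_eqF//.
    by rewrite [`|v - u|]gtr0_norm ?subr_gt0//; exact: ltW.
  apply/eqP; rewrite eq_le outer_measure_ge0 andbT.
  apply/lee_addgt0Pr => e e0; rewrite add0e.
  have VV : 0 <= V b - V a.
    rewrite /V total_variationxx subr0.
    exact: le_trans (normr_ge0 _) (fine_TV_ge bv (lexx a) (ltW ab) (lexx b)).
  (* The added 1 keeps the denominator positive when the variation vanishes. *)
  have e1 : 0 < e / (10 * (V b - V a) + 1) by rewrite divr_gt0//; lra.
  have [n _ /(_ n (leqnn n)) /= ne] := near_infty_natSinv_lt (PosNum e1).
  apply: (le_trans (IV n)); rewrite lee_fin.
  move: ne; rewrite ltr_pdivlMr; last lra.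
  have : 0 <= n.+1%:R^-1 :> R by rewrite invr_ge0.
  by set d := n.+1%:R^-1; nra.
have O0 c k : outer (O c k) = 0%E.
  pose g := f \+ (fun t => - ratr c * t).
  have bvg : bounded_variation a b g.
    by apply: bounded_variationD => //; apply: bounded_variation_linear; exact: ltW.
  apply: (@opposite_slopes_null g a b k.+1%:R^-1) => //.
  - exact: ltW.
  - by move=> x [].
  - move=> x [_ [lo _]]; apply: frequent_slope_add.
    by apply: (frequent_slope_impl _ lo) => q; set d := k.+1%:R^-1; lra.
  - move=> x [_ [_ hi]]; apply: frequent_slope_add.
    by apply: (frequent_slope_impl _ hi) => q; set d := k.+1%:R^-1; lra.
have neg : (@lebesgue_measure R).-negligible (I `|` \bigcup_n O' n).
  apply: negligibleU; first exact/negligible_outer_measure.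
  apply: negligible_bigcup => n; rewrite /O'.
  case: (unpickle n) => [[c k]|]; last exact: negligible_set0.
  exact/negligible_outer_measure.
by apply: negligibleS neg; exact: sub.
Qed.

(** The variation is controlled on compact subintervals of []a n, b n[], so each of these is
    exhausted by the intervals shortened by [j.+1%:R^-1] at both ends. What remains is countable,
    hence null. *)
Lemma CBV_derivable_ae f : CBV f ->
  (@lebesgue_measure R).-negligible [set x | ~ derivable f x 1].
Proof.
move=> [a [b [ab _ bv cD]]].
pose E n j := [set x | `]a n + j.+1%:R^-1, b n - j.+1%:R^-1[%classic x /\
  ~ derivable f x 1].
have neg : (@lebesgue_measure R).-negligible
    ((~` \bigcup_n `]a n, b n[%classic) `|` \bigcup_n \bigcup_j E n j).
  apply: negligibleU.
    by apply/negligible_outer_measure; exact: countable_lebesgue_measure0.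
  apply: negligible_bigcup => n; apply: negligible_bigcup => j.
  have [ba|ltab] := leP (b n - j.+1%:R^-1) (a n + j.+1%:R^-1).
    rewrite /E set_itv_ge ?bnd_simp -?leNgt//.
    by apply: negligibleS (negligible_set0 _) => x [].
  apply: bounded_variation_derivable_ae.
  have [M HM] := bv n.
  have j0 : 0 < j.+1%:R^-1 :> R by rewrite invr_gt0.
  apply/bounded_variationP; first exact: ltW.
  rewrite ge0_fin_numE; last by apply: total_variation_ge0; exact: ltW.
  by apply: (le_lt_trans _ (ltry M)); apply: HM;
    move: j0 ltab; set d := _.+1%:R^-1; lra.
apply: negligibleS neg => x ndx.
have [[n _ /=]|nx] := pselect ((\bigcup_n `]a n, b n[%classic) x); last by left.
rewrite in_itv/= => /andP[ax xb]; right; exists n => //.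
have m0 : 0 < Num.min (x - a n) (b n - x) by rewrite lt_min !subr_gt0 ax.
have [j _ /(_ j (leqnn j)) /=] := near_infty_natSinv_lt (PosNum m0).
rewrite lt_min => /andP[j1 j2].
exists j => //; split => //=; rewrite in_itv/=.
by move: j1 j2; set d := j.+1%:R^-1 => j1 j2; apply/andP; split; lra.
Qed.

End LebesgueDifferentiation.

(** * Riemann-Stieltjes integrals *)

Section RiemannStieltjesCriterion.
Context {R : realType}.
Implicit Types (f g J W : R -> R) (a b eta : R).

Lemma partition_bounds (p : nat) (t : nat -> R) :
  (forall k, (k < p)%N -> t k <= t k.+1) ->
  forall k, (k <= p)%N -> t 0%N <= t k <= t p.
Proof.
move=> tle; have mono i j : (i <= j)%N -> (j <= p)%N -> t i <= t j.
  elim: j => [|j IH]; first by rewrite leqn0 => /eqP ->.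
  rewrite leq_eqVlt => /predU1P[->//|ij jp].
  exact: le_trans (IH ij (ltnW jp)) (tle _ jp).
by move=> k kp; rewrite !mono.
Qed.

(* Summation by parts turns the sums of [g df] into sums of [f dg], up to
   boundary terms; comparing these with the increments of [J] cell by cell
   covers both the existence of the integral and the estimates at the
   boundary of the disc ([J = 0]). *)
Lemma RS_sum_by_parts f g J W a b eta :
  (forall x y, a <= x -> x <= y -> y <= b -> y - x < eta ->
    `|f x * (g y - g x) - (J y - J x)| <= W y - W x /\
    `|f y * (g y - g x) - (J y - J x)| <= W y - W x) ->
  forall (p : nat) (t tau : nat -> R),
    t 0%N = a -> t p = b ->
    (forall k, (k < p)%N ->
      [/\ t k <= t k.+1, t k.+1 - t k < eta & t k <= tau k <= t k.+1]) ->
    `|\sum_(0 <= k < p) g (tau k) * (f (t k.+1) - f (t k))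
       - (g b * f b - g a * f a - (J b - J a))| <= W b - W a.
Proof.
move=> cell p t tau t0 tp part.
have tab k : (k <= p)%N -> a <= t k <= b.
  rewrite -t0 -tp; apply: partition_bounds => i ip; by have [] := part i ip.
rewrite -tp -t0.
have : forall q, (q <= p)%N ->
  `|\sum_(0 <= k < q) g (tau k) * (f (t k.+1) - f (t k))
     - (g (t q) * f (t q) - g (t 0%N) * f (t 0%N) - (J (t q) - J (t 0%N)))|
  <= W (t q) - W (t 0%N); last by apply.
elim=> [_|q IH qp].
  by rewrite big_geq// !subrr normr0.
rewrite big_nat_recr//=; move: (IH (ltnW qp)).
have [tt dt /andP[ttau taut]] := part q qp.
have /andP[atq _] := tab q (ltnW qp); have /andP[_ tqb] := tab q.+1 qp.
(* The cell is split at its tag: [f (t q)] multiplies the increment of [g] before [tau q], and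
   [f (t q.+1)] the one after it. Hence the hypothesis on the values of [f] at both endpoints. *)
have [+ _] := cell (t q) (tau q) atq ttau (le_trans taut tqb) ltac:(lra).
have [_ +] := cell (tau q) (t q.+1) (le_trans atq ttau) taut tqb ltac:(lra).
set S := \sum_(0 <= _ < _) _.
rewrite !ler_norml => /andP[h1 h2] /andP[h3 h4] /andP[h5 h6].
by apply/andP; split; lra.
Qed.

End RiemannStieltjesCriterion.

(** * Existence of the integral for an almost everywhere continuous integrator *)

Section RiemannStieltjesExistence.
Context {R : realType}.
Implicit Types (f g dg : R -> R) (a b eta e x y : R).
Let mu := @lebesgue_measure R.

(** Comparing two nearby points makes this set open for arbitrary [f], hence measurable. For
    [e > 0], a point belonging to it for every positive [eta] is a discontinuity of [f]. *)
Let oscillating f e eta : set R :=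
  [set s | exists u v, [/\ `|u - s| < eta, `|v - s| < eta & e < `|f u - f v|]].

Let open_oscillating f e eta : open (oscillating f e eta).
Proof.
rewrite openE => s [u [v [us vs fuv]]].
have d0 : 0 < eta - Num.max `|u - s| `|v - s| by rewrite subr_gt0 gt_max us.
apply/nbhs_ballP; exists (eta - Num.max `|u - s| `|v - s|) => //= s' ss'.
have m1 : `|u - s| <= Num.max `|u - s| `|v - s| by rewrite le_max lexx.
have m2 : `|v - s| <= Num.max `|u - s| `|v - s| by rewrite le_max lexx orbT.
rewrite /ball/= in ss'.
exists u, v; split => //.
  by rewrite (le_lt_trans (ler_distD s _ _))//; lra.
by rewrite (le_lt_trans (ler_distD s _ _))//; lra.
Qed.

(** Along [eta = n.+1%:R^-1] the sets decrease within [[a, b]] to a set of discontinuities, so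
    continuity from above of the measure applies. *)
Let oscillating_small f e : 0 < e -> mu.-negligible [set s | ~ {for s, continuous f}] ->
  forall a b d, 0 < d -> exists2 eta, 0 < eta &
    (mu (oscillating f e eta `&` `[a, b]) < d%:E)%E.
Proof.
move=> e0 negf a b d d0.
pose U n := oscillating f e n.+1%:R^-1 `&` `[a, b]%classic.
have mU n : measurable (U n).
  by apply: measurableI => //; apply: open_measurable; exact: open_oscillating.
have U0 : mu (\bigcap_n U n) = 0%E.
  apply/negligibleP; first exact: bigcapT_measurable.
  apply: negligibleS negf => s Us /(cvgrPdist_lt _ (f s)) cf.
  have /nbhs_ballP[r /= r0 Hr] := cf (e / 2) ltac:(lra).
  have [n _ /(_ n (leqnn n)) /= nr] := near_infty_natSinv_lt (PosNum r0).
  have [[u [v [us vs fuv]]] _] := Us n I.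
  have Hu := Hr u; have Hv := Hr v; rewrite /ball/= in Hu Hv.
  have {}Hu := Hu ltac:(rewrite distrC; exact: lt_trans us nr).
  have {}Hv := Hv ltac:(rewrite distrC; exact: lt_trans vs nr).
  have := ler_distD (f s) (f u) (f v); rewrite (distrC (f u) (f s)).
  by move: Hu Hv fuv => /=; lra.
have Udecr : {homo U : n m / (n <= m)%N >-> m `<=` n}.
  move=> n m nm s [[u [v [us vs fuv]]] sab]; split => //.
  have nm' : m.+1%:R^-1 <= n.+1%:R^-1 :> R.
    by rewrite lef_pV2 ?posrE// ler_nat.
  by exists u, v; split => //; [exact: lt_le_trans us nm'|exact: lt_le_trans vs nm'].
have Ufin : (mu (U 0%N) < +oo)%E.
  apply: (@le_lt_trans _ _ (mu `[a, b]%classic)).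
    apply: le_measure; rewrite ?inE; [exact: mU|exact: measurable_itv|].
    exact: subIsetr.
  by rewrite /mu lebesgue_measure_itv/=; case: ifP => _; rewrite -?EFinB ltry.
have : mu (U n) @[n --> \oo] --> mu (\bigcap_n U n).
  apply: nonincreasing_cvg_mu => //; first exact: bigcapT_measurable.
  by move=> n m nm; apply/subsetPset; exact: Udecr.
rewrite U0 => /fine_cvgP[fin /cvgrPdist_lt /(_ d d0) [N _ HN]].
move: fin => [N' _ HN'].
exists (maxn N N').+1%:R^-1; first by rewrite invr_gt0.
have := HN (maxn N N') (leq_maxl _ _); have := HN' (maxn N N') (leq_maxr _ _).
rewrite /= sub0r normrN => fin; rewrite -/(U (maxn N N')) -(fineK fin) lte_fin.
exact: le_lt_trans (ler_norm _).
Qed.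

(** The integral is the boundary term minus the Lebesgue integral of [f * dg]. In [RS_sum_by_parts],
    [J] is the indefinite integral of [f * dg], and [W] that of a function dominating the error in a
    cell: it uses the oscillation bound [e] off [U] and adds [2 * M] on [U], a set of small measure
    in [[a, b]]. *)
Lemma RS_integrable_of_continuous_ae f g dg a b (K M : R) :
  a <= b ->
  (forall x, is_derive x 1 g (dg x)) -> continuous dg ->
  (forall x, `|dg x| <= K) -> (forall x, `|f x| <= M) ->
  mu.-negligible [set x | ~ {for x, continuous f}] ->
  RS_integrable g f a b.
Proof.
move=> ab gdg cdg dgK fM negf.
have [A [mA A0 negA]] := negf.
(* [f] itself may fail to be Borel measurable; setting it to 0 on a measurable null set containing
   its discontinuities repairs this. *)
pose f0 := f \_ (~` A).
have f0M x : `|f0 x| <= M.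
  rewrite /f0 patchE; case: ifP => _ //.
  by rewrite normr0 (le_trans _ (fM x)).
have K0 : 0 <= K by exact: le_trans (normr_ge0 _) (dgK 0).
have M0 : 0 <= M by exact: le_trans (normr_ge0 _) (fM 0).
have mf0 : measurable_fun setT f0.
  have mAC : measurable (~` A) by exact: measurableC.
  apply/(measurable_restrictT _ mAC).
  apply: subspace_continuous_measurable_fun => //.
  apply/subspace_continuousP => x Ax; apply: cvg_within_filter.
  by apply: contrapT => /negA.
have bounded_integrable (h : R -> R) (C x y : R) : measurable_fun setT h ->
    (forall s, `|h s| <= C) -> mu.-integrable `[x, y] (EFin \o h).
  move=> mh hC; apply: measurable_bounded_integrable => //.
  - rewrite -[X in (X < _)%E]/(lebesgue_measure `[x, y]%classic).
    by rewrite lebesgue_measure_itv/=; case: ifP => _; rewrite -?EFinB ltry.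
  - exact: measurable_funS mh.
  - exists C; split; first exact: num_real.
    by move=> C' CC' s _ /=; rewrite (le_trans (hC s))// ltW.
have cumulB (h : R -> R) (C : R) : measurable_fun setT h ->
    (forall s, `|h s| <= C) -> forall x y, a <= x -> x <= y ->
    \int[mu]_(s in `[a, y]) h s - \int[mu]_(s in `[a, x]) h s =
    \int[mu]_(s in `[x, y]) h s.
  move=> mh hC x y ax xy.
  rewrite Rintegral_itvB ?bnd_simp//; last exact: bounded_integrable mh hC.
  apply: Rintegral_itv_obnd_cbnd.
  apply: integrableS (bounded_integrable _ _ x y mh hC) => //.
  exact: subset_itv_oc_cc.
have FTC x y : x <= y -> \int[mu]_(s in `[x, y]) dg s = g y - g x.
  rewrite le_eqVlt => /predU1P[<-|xy].
    by rewrite set_itv1 Rintegral_set1 subrr.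
  have cg s : {for s, continuous g}.
    by apply: differentiable_continuous; apply/derivable1_diffP; have [] := gdg s.
  rewrite /Rintegral (@continuous_FTC2 _ dg g)//.
  - exact: continuous_subspaceT.
  - split.
    + by move=> s _; have [] := gdg s.
    + exact: cvg_at_right_filter (cg x).
    + exact: cvg_at_left_filter (cg y).
  - by move=> s _; rewrite derive1E; have [_ ->] := gdg s.
have mdg : measurable_fun setT dg by exact: continuous_measurable_fun.
have mf0dg : measurable_fun setT (f0 \* dg) by exact: measurable_funM.
have f0dgK s : `|(f0 \* dg) s| <= M * K by rewrite normrM ler_pM.
pose J x := \int[mu]_(s in `[a, x]) (f0 \* dg) s.
exists (g b * f b - g a * f a - (J b - J a)) => eps eps0.
(* [W b - W a] equals [K * (e * (b - a) + 2 * M * m)], with [m] the measure of [U] in [[a, b]]; this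
   [e] and the bound [d0] for [m] make both summands at most [eps / 3]. The added ones keep the
   denominators positive. *)
pose e := eps / (3 * ((K + 1) * (b - a + 1))).
have e0 : 0 < e by rewrite divr_gt0// !mulr_gt0//; lra.
have d0 : 0 < eps / (3 * ((K + 1) * (2 * M + 1))).
  by rewrite divr_gt0// !mulr_gt0//; lra.
have [eta eta0 small] := oscillating_small e0 negf a b d0.
pose U := oscillating f e eta `|` A.
have mosc : measurable (oscillating f e eta).
  by apply: open_measurable; exact: open_oscillating.
have mU : measurable U by exact: measurableU.
pose h (s : R) : R := K * (e + 2 * M * \1_U s).
have mh : measurable_fun setT h.
  apply: measurable_funM => //; apply: measurable_funD => //.
  by apply: measurable_funM => //; exact: measurable_indic.
have indU (s : R) : 0 <= (\1_U s : R) <= 1.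
  by rewrite indicE; case: (s \in U); rewrite ?lexx ?ler01.
have hC s : `|h s| <= K * (e + 2 * M).
  have /andP[i0 i1] := indU s.
  have Mi : 0 <= M * \1_U s by rewrite mulr_ge0.
  have Mi' : M * \1_U s <= M by rewrite ler_piMr.
  rewrite /h normrM (ger0_norm K0) ler_wpM2l// -mulrA.
  by clear - e0 Mi Mi'; rewrite ger0_norm; lra.
pose W x := \int[mu]_(s in `[a, x]) h s.
exists eta => // p t tau t0 tp part.
have Wb : W b - W a < eps.
  have iind : mu.-integrable `[a, b] (EFin \o (\1_U : R -> R)).
    apply: (bounded_integrable _ 1); first exact: measurable_indic.
    by move=> s; have /andP[? ?] := indU s; rewrite ger0_norm.
  have icst (C : R) : mu.-integrable `[a, b] (EFin \o (fun=> C)).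
    by apply: (bounded_integrable _ `|C|).
  have iMind : mu.-integrable `[a, b] (EFin \o (fun s => 2 * M * (\1_U s : R))).
    apply: (bounded_integrable _ (2 * M)).
      by apply: measurable_funM => //; exact: measurable_indic.
    move=> s; have /andP[? ?] := indU s.
    by rewrite ger0_norm ?mulr_ge0// ler_piMr ?mulr_ge0.
  have isum : mu.-integrable `[a, b] (EFin \o (fun s => e + 2 * M * (\1_U s : R))).
    apply: (bounded_integrable _ (e + 2 * M)).
      apply: measurable_funD => //.
      by apply: measurable_funM => //; exact: measurable_indic.
    move=> s; have /andP[i0 i1] := indU s.
    have Mi : 0 <= 2 * M * (\1_U s : R) by rewrite !mulr_ge0.
    have Mi' : 2 * M * (\1_U s : R) <= 2 * M by rewrite ler_piMr ?mulr_ge0.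
    by clear - e0 Mi Mi'; rewrite ger0_norm; lra.
  rewrite /W (cumulB _ _ mh hC)// /h RintegralZl// RintegralD// Rintegral_cst//.
  rewrite RintegralZl// {1}/Rintegral integral_indic//.
  have -> : fine (mu `[a, b]%classic) = b - a.
    rewrite /mu lebesgue_measure_itv/= lte_fin; case: ltP => // ba.
    by rewrite /=; lra.
  set m := fine _.
  have md : m < eps / (3 * ((K + 1) * (2 * M + 1))).
    have mUd : (mu (U `&` `[a, b]) < (eps / (3 * ((K + 1) * (2 * M + 1))))%:E)%E.
      apply: le_lt_trans small.
      rewrite -[leRHS]adde0 -A0.
      apply: le_trans (measureU2 _ _ _).
      - apply: le_measure; rewrite ?inE.
        + exact: measurableI.
        + by apply: measurableU => //; exact: measurableI.
        + by move=> s [[Us|As] sab]; [left; split|right].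
      - exact: measurableI.
      - exact: mA.
    rewrite -lte_fin fineK// ge0_fin_numE//.
    exact: lt_le_trans mUd (leey _).
  have m0 : 0 <= m by rewrite fine_ge0.
  have eE : e * ((K + 1) * (b - a + 1)) = eps / 3.
    by rewrite /e; field; clear - ab K0; apply/andP; split; rewrite gt_eqF//; lra.
  have dE : eps / (3 * ((K + 1) * (2 * M + 1))) * ((K + 1) * (2 * M + 1)) = eps / 3.
    by field; clear - K0 M0; apply/andP; split; rewrite gt_eqF//; lra.
  move: d0 md dE; set d := eps / _ => d0 md dE.
  have H1 : K * (e * (b - a)) <= e * ((K + 1) * (b - a + 1)).
    by rewrite mulrCA ler_wpM2l ?(ltW e0)// ler_pM ?subr_ge0 ?lerDl.
  have H2 : K * (2 * M * m) <= d * ((K + 1) * (2 * M + 1)).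
    rewrite [leLHS]mulrA [leRHS]mulrC ler_pM ?mulr_ge0//; last exact: ltW.
    by rewrite ler_pM ?mulr_ge0 ?lerDl.
  by rewrite mulrDr; clear - H1 H2 eE dE eps0; lra.
apply: le_lt_trans Wb; apply: RS_sum_by_parts t0 tp part.
move=> x y ax xy yb xy_eta.
have cell z : x <= z <= y ->
    `|f z * (g y - g x) - (J y - J x)| <= W y - W x.
  move=> /andP[xz zy].
  rewrite /J /W (cumulB _ _ mh hC)// (cumulB _ _ mf0dg f0dgK)//.
  have iz : mu.-integrable `[x, y] (EFin \o (fun s => f z * dg s)).
    apply: (bounded_integrable _ (M * K)); first exact: measurable_funM.
    by move=> s; rewrite normrM ler_pM.
  have idg : mu.-integrable `[x, y] (EFin \o dg) by exact: bounded_integrable mdg dgK.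
  have if0 : mu.-integrable `[x, y] (EFin \o (f0 \* dg)).
    exact: bounded_integrable mf0dg f0dgK.
  rewrite -(FTC x y xy) -RintegralZl// -RintegralB//.
  have mB : measurable_fun setT (fun s => f z * dg s - (f0 \* dg) s).
    by apply: measurable_funB => //; exact: measurable_funM.
  have bB s : `|f z * dg s - (f0 \* dg) s| <= M * K + M * K.
    by apply: le_trans (ler_normB _ _) _; rewrite lerD// normrM ler_pM.
  apply: le_trans.
    by apply: le_normr_Rintegral => //; exact: bounded_integrable mB bB.
  apply: le_Rintegral => //.
  - apply: (bounded_integrable _ (M * K + M * K)).
      exact: measurableT_comp.
    by move=> s; rewrite normr_id.
  - exact: bounded_integrable mh hC.
  move=> s; rewrite /= in_itv/= => /andP[xs sy].
  rewrite -mulrBl normrM mulrC ler_pM//.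
  have [sU|sU] := pselect (U s).
    rewrite indicE mem_set// mulr1.
    apply: le_trans (ler_normB _ _) _.
    by have := fM z; have := f0M s; clear - e0; lra.
  rewrite indicE memNset// mulr0 addr0.
  have sA : ~ A s by move=> As; apply: sU; right.
  rewrite /f0 patchE mem_set//.
  (* Both [z] and [s] lie within [eta] of [s], so a larger difference would put [s] into the
     oscillating set. *)
  rewrite leNgt; apply/negP => fzs; apply: sU; left; exists z, s.
  split => //; last by rewrite subrr normr0.
  by rewrite ltr_norml; clear - xy_eta xz zy xs sy; apply/andP; split; lra.
by split; apply: cell; rewrite ?lexx ?xy.
Qed.
End RiemannStieltjesExistence.

(** * The Poisson kernel *)

Section Trigo.
Context {R : realType}.
Implicit Types (x y u w r theta : R) (f g df : R -> R).

(** Up to 1, [1 - cos w] is twice the square of [sin (w / 2)], which is at least [cos 1 * (w / 2)]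
    by the mean value theorem. From 1 to [W] it is at least the smaller of its values at 1 and [W],
    since [cos] first decreases, then increases. [W] may exceed [pi], as differences of two angles
    do. *)
Lemma one_sub_cos_ge (W : R) : 0 < W < 2 * pi ->
  exists2 kappa : R, 0 < kappa & forall w, `|w| <= W ->
    kappa * w ^+ 2 <= 1 - cos w.
Proof.
move=> /andP[W0 W2pi].
have pi1 : 1 < pi :> R by have := pi_ge2 R; lra.
have cos1 : cos 1 < 1 :> R.
  by rewrite -[ltRHS]cos0 ltr_cos// in_itv/=; apply/andP; split; lra.
have cosW : cos W < 1.
  have [Wpi|Wpi] := leP W pi.
    by rewrite -[ltRHS]cos0 ltr_cos// in_itv/=; apply/andP; split; lra.
  rewrite -cosN -(cosD2pi (- W)) -[ltRHS]cos0 ltr_cos// ?in_itv/= ?mulr2n ?lexx ?pi_ge0//.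
    lra.
  by apply/andP; split; lra.
pose m := Num.min (1 - cos 1) (1 - cos W).
have m0 : 0 < m by rewrite lt_min !subr_gt0 cos1.
have cos1_gt0 : 0 < cos 1 :> R.
  exact: cos1_gt0.
exists (Num.min (cos 1 ^+ 2 / 2) (m / W ^+ 2)).
  by rewrite lt_min !divr_gt0// exprn_gt0.
move=> w; wlog w0 : w / 0 <= w => [H|].
  have [/H//|w0] := leP 0 w.
  rewrite -(normrN w) -(cosN w) -(sqrrN w); by apply: H; rewrite oppr_ge0 ltW.
rewrite (ger0_norm w0) => wW.
have [w1|w1] := leP w 1.
  apply: (@le_trans _ _ (cos 1 ^+ 2 / 2 * w ^+ 2)).
    by rewrite ler_wpM2r ?sqr_ge0// ge_min lexx.
  have -> : cos w = 1 - 2 * sin (w / 2) ^+ 2.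
    by rewrite {1}(_ : w = w / 2 + w / 2) ?cosD; have := cos2Dsin2 (w / 2); nra.
  have : cos 1 * (w / 2) <= sin (w / 2).
    have [|c c01] := @MVT_segment R sin cos 0 (w / 2) ltac:(lra) (fun z _ => is_derive_sin z).
      by apply: derivable_within_continuous => z _; have [] := is_derive_sin z.
    rewrite sin0 !subr0 => ->; rewrite ler_wpM2r; [by []|lra|].
    move: c01; rewrite in_itv/= => /andP[c0 cw].
    have [->//|c1] := eqVneq c 1.
    rewrite ltW// ltr_cos ?in_itv/=; [|apply/andP; split; lra..].
    by rewrite lt_neqAle c1; lra.
  move=> sw; have : (cos 1 * (w / 2)) ^+ 2 <= sin (w / 2) ^+ 2.
    have cw0 : 0 <= cos 1 * (w / 2) by rewrite mulr_ge0 ?divr_ge0// ltW.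
    by rewrite lerXn2r ?nnegrE// (le_trans cw0).
  nra.
apply: (@le_trans _ _ (m / W ^+ 2 * w ^+ 2)).
  by rewrite ler_wpM2r ?sqr_ge0// ge_min lexx orbT.
apply: (@le_trans _ _ m).
  rewrite mulrAC ler_pdivrMr ?exprn_gt0// ler_wpM2l ?(ltW m0)//.
  by rewrite lerXn2r ?nnegrE// ltW.
rewrite ge_min; apply/orP.
have [wpi|wpi] := leP w pi; [left|right]; rewrite lerD2l lerN2.
  by rewrite ltW// ltr_cos ?in_itv/=; [lra|apply/andP; split; lra..].
rewrite -(cosN w) -(cosN W) -(cosD2pi (- w)) -(cosD2pi (- W)).
have [->//|wW'] := eqVneq w W.
rewrite ltW// ltr_cos ?in_itv/= ?mulr2n; [|apply/andP; split; lra..].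
by rewrite ltrD2r ltrN2 lt_neqAle wW'.
Qed.

Lemma MVT_bound f df x y (K : R) : x <= y ->
  (forall z, z \in `[x, y] -> is_derive z 1 f (df z)) ->
  (forall z, z \in `[x, y] -> `|df z| <= K) ->
  `|f y - f x| <= K * (y - x).
Proof.
move=> xy fdf dfK.
have [|c cxy ->] := @MVT_segment R f df x y xy (fun z zxy => fdf z (subset_itv_oo_cc zxy)).
  apply: derivable_within_continuous => z zxy.
  by have [] := fdf z zxy.
rewrite normrM (ger0_norm (_ : 0 <= y - x)) ?subr_ge0//.
by rewrite ler_wpM2r ?subr_ge0// dfK.
Qed.

Lemma norm_sin_le x : `|sin x| <= `|x|.
Proof.
wlog x0 : x / 0 <= x => [H|].
  have [/H//|x0] := leP 0 x.
  by rewrite -(normrN (sin x)) -sinN -(normrN x) H// oppr_ge0 ltW.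
have := @MVT_bound sin cos 0 x 1 x0.
rewrite sin0 !subr0 mul1r (ger0_norm x0); apply => z _.
by rewrite ler_norml cos_geN1 cos_le1.
Qed.

Lemma denom_gt0 r u : 0 <= r < 1 -> 0 < 1 - 2 * r * cos u + r ^+ 2.
Proof.
move=> /andP[r0 r1]; have := cos_le1 u.
have : 0 < (1 - r) ^+ 2 by rewrite exprn_gt0//; lra.
nra.
Qed.

Lemma is_derive_div f g u (a b : R) :
  is_derive u 1 f a -> is_derive u 1 g b -> g u != 0 ->
  is_derive u 1 (fun v => f v / g v) ((a * g u - f u * b) / g u ^+ 2).
Proof.
move=> fa gb gu0; have H := is_deriveM fa (is_deriveV gu0 gb).
rewrite [X in is_derive _ _ X _](_ : _ = f * (fun y => (g y)^-1))//.
by apply: (is_derive_eq H); rewrite /GRing.scale/=; field.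
Qed.

Let is_derive_denom r u :
  is_derive u 1 (fun v => 1 - 2 * r * cos v + r ^+ 2) (2 * r * sin u).
Proof.
have H := is_deriveD (is_deriveB (is_derive_cst (1 : R) u 1)
  (is_deriveZ (2 * r) (is_derive_cos u))) (is_derive_cst (r ^+ 2) u 1).
by apply: (is_derive_eq H); rewrite addr0 sub0r scalerN opprK.
Qed.

Lemma is_derive_poisson_kernel r u : 0 <= r < 1 ->
  is_derive u 1 (poisson_kernel r)
    (- ((1 - r ^+ 2) * (2 * r * sin u)) / (1 - 2 * r * cos u + r ^+ 2) ^+ 2).
Proof.
move=> r01; have D0 := denom_gt0 u r01.
have nz : 1 - 2 * r * cos u + r ^+ 2 != 0 by rewrite gt_eqF.
have H := is_derive_div (is_derive_cst (1 - r ^+ 2) u 1) (is_derive_denom r u) nz.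
by apply: (is_derive_eq H); rewrite mul0r sub0r.
Qed.

(** The [atan] term is minus the argument of [1 - r * expi u]. For [0 <= r < 1] this form is smooth
    on the whole line, and it grows by [2 * pi] over a period, the total mass of the kernel. *)
Definition poisson_antiderivative r u : R :=
  u + 2 * atan (r * sin u / (1 - r * cos u)).

Lemma is_derive_poisson_antiderivative r u : 0 <= r < 1 ->
  is_derive u 1 (poisson_antiderivative r) (poisson_kernel r u).
Proof.
move=> r01; have D0 := denom_gt0 u r01.
have d0 : 0 < 1 - r * cos u by have := cos_le1 u; move: r01 => /andP[]; nra.
have dnum : is_derive u 1 (fun v => r * sin v) (r * cos u) by exact: is_deriveZ.
have dden : is_derive u 1 (fun v => 1 - r * cos v) (r * sin u).
  have H := is_deriveB (is_derive_cst (1 : R) u 1)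
    (is_deriveZ r (is_derive_cos u)).
  by apply: (is_derive_eq H); rewrite sub0r scalerN opprK.
have d0' : 1 - r * cos u != 0 by rewrite gt_eqF.
have dq := is_derive_div dnum dden d0'.
have datan := @is_derive1_comp R atan (fun v => r * sin v / (1 - r * cos v)) u
  _ _ (is_derive1_atan _) dq.
have H := is_deriveD (is_derive_id u 1) (is_deriveZ 2 datan).
rewrite /poisson_antiderivative /poisson_kernel.
apply: (is_derive_eq H).
rewrite /GRing.scale/=.
have sc : sin u ^+ 2 = 1 - cos u ^+ 2 by rewrite -(cos2Dsin2 u); ring.
have E1 : 1 + (r * sin u / (1 - r * cos u)) ^+ 2 =
    (1 - 2 * r * cos u + r ^+ 2) / (1 - r * cos u) ^+ 2.
  rewrite expr_div_n exprMn sc; field; exact: d0'.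
have E2 : r * cos u * (1 - r * cos u) - r * sin u * (r * sin u) =
    r * cos u - r ^+ 2.
  have -> : r * sin u * (r * sin u) = r ^+ 2 * sin u ^+ 2 by ring.
  by rewrite sc; ring.
rewrite E1 E2; move: D0 => /lt0r_neq0 D0; field.
by rewrite D0 d0'.
Qed.

Lemma poisson_antiderivative_2pi r u :
  poisson_antiderivative r (u + 2 * pi) = poisson_antiderivative r u + 2 * pi.
Proof.
by rewrite /poisson_antiderivative !mulr_natl sinD2pi cosD2pi addrAC.
Qed.
End Trigo.

(** * Kernel estimates for the boundary behaviour *)

Section Fatou.
Context {R : realType}.
Implicit Types (f g df dg W dW Phi : R -> R) (a b x y u w r theta : R).

(** The denominator is [(1 - r) ^+ 2 + 2 * r * (1 - cos u)], where [2^-1 <= r] makes [2 * r] at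
    least 1 and [one_sub_cos_ge] bounds the other factor. *)
Lemma poisson_denom_ge (W : R) : 0 < W < 2 * pi -> exists2 k : R, 0 < k <= 1 &
  forall r u, 2^-1 <= r < 1 -> `|u| <= W ->
    k * ((1 - r) ^+ 2 + u ^+ 2) <= 1 - 2 * r * cos u + r ^+ 2.
Proof.
move=> W0; have [kap kap0 Hkap] := one_sub_cos_ge W0.
exists (Num.min 1 kap); first by rewrite lt_min ltr01 kap0 ge_min lexx.
move=> r u /andP[r1 r2] /Hkap uk.
have k1 : Num.min 1 kap <= 1 by rewrite ge_min lexx.
have k2 : Num.min 1 kap <= kap by rewrite ge_min lexx orbT.
have k0 : 0 < Num.min 1 kap by rewrite lt_min ltr01.
move: k0 k1 k2; set k := Num.min _ _ => k0 k1 k2.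
have -> : 1 - 2 * r * cos u + r ^+ 2 = (1 - r) ^+ 2 + 2 * r * (1 - cos u).
  by ring.
have h1 : k * (1 - r) ^+ 2 <= (1 - r) ^+ 2 by rewrite ler_piMl// sqr_ge0.
have h2 : k * u ^+ 2 <= kap * u ^+ 2 by rewrite ler_wpM2r// sqr_ge0.
have h3 := cos_le1 u.
have h4 : 1 - cos u <= 2 * r * (1 - cos u) by rewrite ler_peMl; lra.
lra.
Qed.

Lemma ler_derive f df x y : x <= y ->
  (forall z, z \in `[x, y] -> is_derive z 1 f (df z)) ->
  (forall z, z \in `[x, y] -> 0 <= df z) -> f x <= f y.
Proof.
move=> xy fdf df0.
have [|c cxy E] := @MVT_segment R f df x y xy
    (fun z zxy => fdf z (subset_itv_oo_cc zxy)).
  by apply: derivable_within_continuous => z zxy; have [] := fdf z zxy.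
by rewrite -subr_ge0 E mulr_ge0 ?df0// subr_ge0.
Qed.

(** Both [W - c * g] and [W + c * g] are nondecreasing. This supplies the cell hypothesis of
    [RS_sum_by_parts] when [J] is constant. *)
Lemma MVT_dominated g dg W dW (c x y : R) : x <= y ->
  (forall z, z \in `[x, y] -> is_derive z 1 g (dg z)) ->
  (forall z, z \in `[x, y] -> is_derive z 1 W (dW z)) ->
  (forall z, z \in `[x, y] -> `|c| * `|dg z| <= dW z) ->
  `|c * (g y - g x)| <= W y - W x.
Proof.
move=> xy gdg WdW dgW.
have H1 : W x - c * g x <= W y - c * g y.
  apply: (@ler_derive (fun z => W z - c * g z) (fun z => dW z - c * dg z)) => //.
    move=> z zxy; have H := is_deriveB (WdW z zxy) (is_deriveZ c (gdg z zxy)).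
    exact: (is_derive_eq H).
  move=> z zxy; rewrite subr_ge0 (le_trans _ (dgW z zxy))//.
  by rewrite -normrM ler_norm.
have H2 : W x + c * g x <= W y + c * g y.
  apply: (@ler_derive (fun z => W z + c * g z) (fun z => dW z + c * dg z)) => //.
    move=> z zxy; have H := is_deriveD (WdW z zxy) (is_deriveZ c (gdg z zxy)).
    exact: (is_derive_eq H).
  move=> z zxy; have := dgW z zxy; rewrite -normrM => dgWz.
  by have := ler_norm (- (c * dg z)); rewrite normrN; lra.
by rewrite mulrBr ler_norml; apply/andP; split; lra.
Qed.

(* The cubic term absorbs the bound on [f] away from the point under
   consideration, which makes a case distinction in the integral superfluous. *)
Lemma kernel_times_increment_le (p m e B C K F G : R) :
  0 < p -> 0 <= m -> 0 <= e -> 0 <= B -> 1 <= C -> 0 <= K -> 0 <= F -> 0 <= G ->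
  F <= e * (m + C * p) + B * (m + C * p) ^+ 3 ->
  G <= K * (p * m) / (p ^+ 2 + m ^+ 2) ^+ 2 ->
  F * G <= K * e * (2 * C) * (p / (p ^+ 2 + m ^+ 2)) +
           K * B * (16 * C ^+ 4) * p.
Proof.
move=> p0 m0 e0 B0 C1 K0 F0 G0 FH GH.
set q := p ^+ 2 + m ^+ 2 in GH *.
have q0 : 0 < q by rewrite /q; nra.
have Cp0 : 0 <= C * p by rewrite mulr_ge0//; lra.
(* Since [m] and [p] are at most the square root of [q], the products of [m] with the linear and the
   cubic term are of order [q] and [q ^+ 2], against [q ^+ 2] in the denominator. *)
have mCp : m * (m + C * p) <= 2 * C * q.
  have h1 : m ^+ 2 <= C * q.
    by apply: (@le_trans _ _ (1 * q)); [rewrite /q; nra|rewrite ler_wpM2r// ltW].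
  have h2 : m * p <= q by rewrite /q; have := sqr_ge0 (m - p); nra.
  have h3 : C * (m * p) <= C * q by rewrite ler_wpM2l//; lra.
  lra.
have mCp2 : (m + C * p) ^+ 2 <= 4 * C ^+ 2 * q.
  have C2 : 1 <= C ^+ 2 by rewrite exprn_ege1.
  have h1 : (m + C * p) ^+ 2 <= 2 * (m ^+ 2 + C ^+ 2 * p ^+ 2).
    by have := sqr_ge0 (m - C * p); lra.
  have h2 : m ^+ 2 <= C ^+ 2 * m ^+ 2 by rewrite ler_peMl// sqr_ge0.
  have h3 : 0 <= C ^+ 2 * m ^+ 2 by rewrite mulr_ge0// sqr_ge0.
  have h4 : 0 <= C ^+ 2 * p ^+ 2 by rewrite mulr_ge0// sqr_ge0.
  rewrite /q; lra.
have mCp4 : m * (m + C * p) ^+ 3 <= 16 * C ^+ 4 * q ^+ 2.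
  apply: (@le_trans _ _ (((m + C * p) ^+ 2) ^+ 2)).
    rewrite -exprM (exprS _ 3) ler_wpM2r ?exprn_ge0//; lra.
  have -> : 16 * C ^+ 4 * q ^+ 2 = (4 * C ^+ 2 * q) ^+ 2 by ring.
  by rewrite lerXn2r ?nnegrE ?sqr_ge0// (le_trans _ mCp2)// sqr_ge0.
have qi0 : 0 <= (q ^+ 2)^-1 by rewrite invr_ge0 sqr_ge0.
apply: (@le_trans _ _ ((e * (m + C * p) + B * (m + C * p) ^+ 3) *
    (K * (p * m) / q ^+ 2))); first exact: ler_pM.
have -> : (e * (m + C * p) + B * (m + C * p) ^+ 3) * (K * (p * m) / q ^+ 2) =
  K * e * p / q ^+ 2 * (m * (m + C * p)) +
  K * B * p / q ^+ 2 * (m * (m + C * p) ^+ 3) by ring.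
have -> : K * e * (2 * C) * (p / q) + K * B * (16 * C ^+ 4) * p =
  K * e * p / q ^+ 2 * (2 * C * q) + K * B * p / q ^+ 2 * (16 * C ^+ 4 * q ^+ 2).
  by field; rewrite gt_eqF.
by apply: lerD; apply: ler_wpM2l => //; rewrite !mulr_ge0// ltW.
Qed.

(** Tags from the mean value theorem make the sum exact, so the linear part of an integrator is
    evaluated on the same partition as its remainder, without a further limit. *)
Lemma uniform_partition_MVT g G a b eta : a < b -> 0 < eta ->
  (forall x, is_derive x 1 G (g x)) ->
  exists (p : nat) (t tau : nat -> R), [/\ t 0%N = a, t p = b,
    (forall k, (k < p)%N ->
      [/\ t k <= t k.+1, t k.+1 - t k < eta & t k <= tau k <= t k.+1]) &
    \sum_(0 <= k < p) g (tau k) * (t k.+1 - t k) = G b - G a].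
Proof.
move=> ab eta0 Gg.
have [N _ /(_ N (leqnn N)) /= Nab] :=
  near_infty_natSinv_lt (PosNum (divr_gt0 eta0 (ltac:(lra) : 0 < b - a))).
pose t k : R := a + k%:R * ((b - a) / N.+1%:R).
have h0 : 0 < (b - a) / N.+1%:R by rewrite divr_gt0// subr_gt0.
have tS k : t k.+1 - t k = (b - a) / N.+1%:R.
  by rewrite /t -[k.+1]addn1 natrD; ring.
have tau_ex k : exists c, t k <= c <= t k.+1 /\
    g c * (t k.+1 - t k) = G (t k.+1) - G (t k).
  have tk : t k <= t k.+1 by rewrite -subr_ge0 tS ltW.
  have [|c ck E] := @MVT_segment R G g (t k) (t k.+1) tk (fun x _ => Gg x).
    by apply: derivable_within_continuous => x _; have [] := Gg x.
  by exists c; split; [move: ck; rewrite in_itv|].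
have [tau tauP] := choice tau_ex.
exists N.+1, t, tau; split.
- by rewrite /t mul0r addr0.
- by rewrite /t mulrC divfK ?pnatr_eq0// addrC subrK.
- move=> k _; split; first by rewrite -subr_ge0 tS ltW.
    rewrite tS mulrC -ltr_pdivlMr ?subr_gt0//.
  by have [] := tauP k.
- under eq_bigr do rewrite (proj2 (tauP _)).
  rewrite telescope_sumr// /t mul0r addr0 mulrC divfK ?pnatr_eq0//.
  by rewrite [a + _]addrC subrK.
Qed.

Lemma is_derive_reflect f df theta x : (forall u, is_derive u 1 f (df u)) ->
  is_derive x 1 (fun t => f (theta - t)) (- df (theta - x)).
Proof.
move=> fdf.
have d : is_derive x 1 (fun t : R => theta - t) (-1).
  have H := is_deriveB (is_derive_cst theta x 1) (is_derive_id x 1).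
  by apply: (is_derive_eq H); rewrite sub0r.
have H := @is_derive1_comp R f (fun t => theta - t) x _ _ (fdf _) d.
by apply: (is_derive_eq H); rewrite mulrN1.
Qed.

Lemma poisson_kernel_2pi r u : poisson_kernel r (u + 2 * pi) = poisson_kernel r u.
Proof. by rewrite /poisson_kernel [2 * pi]mulr_natl cosD2pi. Qed.

End Fatou.

(** * Convergence at a point of differentiability, in polar coordinates *)

Section FatouTheorem.
Context {R : realType}.
Implicit Types (f g df dg W dW Phi : R -> R) (a b x y u w r theta : R).

(** As [theta0] is away from [pi] and [- pi], the difference [theta - x] keeps distance [b0] from
    the next peaks of the kernel, at [2 * pi] and [- (2 * pi)], and [poisson_denom_ge] covers the
    whole interval. The endpoint value is small because [theta] also stays away from [pi]. *)
Let poisson_reflect_derive_le theta0 (C : R) : - pi < theta0 < pi -> 0 <= C ->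
  exists K d : R, [/\ 0 < K, 0 < d & forall r theta,
    0 <= r < 1 -> 1 - r < d -> `|theta - theta0| <= C * (1 - r) ->
    poisson_kernel r (theta - pi) <= K * (1 - r) /\
    exists dg : R -> R, forall x, - pi <= x <= pi ->
      is_derive x 1 (fun t => poisson_kernel r (theta - t)) (dg x) /\
      `|dg x| <= K * ((1 - r) * `|theta - x|) /
        ((1 - r) ^+ 2 + `|theta - x| ^+ 2) ^+ 2].
Proof.
move=> /andP[t1 t2] C0; have pi0 := pi_gt0 R.
have at0 : `|theta0| < pi by rewrite ltr_norml t1.
have nt0 := normr_ge0 theta0.
pose b0 := (pi - `|theta0|) / 2.
have b0_gt0 : 0 < b0 by rewrite /b0; lra.
have W0 : 0 < 2 * pi - b0 < 2 * pi by apply/andP; split; rewrite /b0; lra.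
have [k /andP[k0 k1] Hk] := poisson_denom_ge W0.
(* This closeness ensures [2^-1 <= r] and puts [theta] within [b0] of [theta0]. In [K] below, the
   first summand serves the derivative and the second the endpoint value. *)
have d0 : 0 < Num.min 2^-1 (b0 / (C + 1)).
  by rewrite lt_min invr_gt0 ltr0n divr_gt0//; lra.
pose K := 4 / k ^+ 2 + 2 / (k * b0 ^+ 2).
have K1 : 0 < 4 / k ^+ 2 by rewrite divr_gt0// exprn_gt0.
have K2 : 0 < 2 / (k * b0 ^+ 2) by rewrite divr_gt0// mulr_gt0// exprn_gt0.
exists K, (Num.min 2^-1 (b0 / (C + 1))); split => //; first exact: addr_gt0.
move=> r theta /andP[r0 r1]; rewrite lt_min => /andP[rd1 rd2] thC.
have p0 : 0 < 1 - r by lra.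
have r12 : 2^-1 <= r < 1 by rewrite r1 andbT; lra.
have thb : `|theta - theta0| < b0.
  apply: le_lt_trans thC _; move: rd2; rewrite ltr_pdivlMr; last lra.
  by have := mulr_ge0 C0 (ltW p0); lra.
have absth : `|theta| < pi - b0.
  have := ler_normD (theta - theta0) theta0; rewrite subrK /b0 in thb *; lra.
have numle : 1 - r ^+ 2 <= 2 * (1 - r) by nra.
have num0 : 0 <= 1 - r ^+ 2 by nra.
have uW x : - pi <= x <= pi -> `|theta - x| <= 2 * pi - b0.
  move=> /andP[x1 x2]; apply: le_trans (ler_normB _ _) _.
  have : `|x| <= pi by rewrite ler_norml x1.
  lra.
split.
  have u1 : `|theta - pi| <= 2 * pi - b0 by apply: uW; clear - pi0; apply/andP; split; lra.
  have u2 : b0 ^+ 2 <= (theta - pi) ^+ 2.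
    have : theta < pi - b0 by apply: le_lt_trans absth; exact: ler_norm.
    move=> ?; have -> : (theta - pi) ^+ 2 = (pi - theta) ^+ 2 by ring.
    have tb : b0 <= pi - theta by lra.
    by rewrite lerXn2r ?nnegrE ?(ltW b0_gt0)// (le_trans (ltW b0_gt0)).
  have D := Hk r _ r12 u1.
  have kb : k * b0 ^+ 2 <= 1 - 2 * r * cos (theta - pi) + r ^+ 2.
    apply: le_trans D; rewrite ler_wpM2l ?(ltW k0)//.
    by apply: le_trans u2 _; rewrite lerDr sqr_ge0.
  have kb0 : 0 < k * b0 ^+ 2 by rewrite mulr_gt0// exprn_gt0.
  apply: (@le_trans _ _ (2 * (1 - r) / (k * b0 ^+ 2))).
    rewrite /poisson_kernel ler_pM ?invr_ge0//.
      exact: le_trans (ltW kb0) kb.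
    by rewrite lef_pV2 ?posrE// (lt_le_trans kb0).
  by rewrite mulrAC ler_wpM2r ?(ltW p0)// /K lerDr ltW.
pose dP u := - ((1 - r ^+ 2) * (2 * r * sin u)) / (1 - 2 * r * cos u + r ^+ 2) ^+ 2.
have r01 : 0 <= r < 1 by rewrite r0.
exists (fun x => - dP (theta - x)) => x xpi; split.
  by apply: is_derive_reflect => u; exact: is_derive_poisson_kernel.
have D := Hk r _ r12 (uW x xpi).
have D0 := denom_gt0 (theta - x) r01.
rewrite normrN /dP; set u := theta - x in D D0 *.
set den := 1 - 2 * r * cos u + r ^+ 2 in D D0 *.
rewrite real_normK ?num_real//.
set q := (1 - r) ^+ 2 + u ^+ 2 in D *.
have q0 : 0 < q by rewrite /q; have := sqr_ge0 u; have := exprn_gt0 2 p0; clear; lra.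
have numb : `|- ((1 - r ^+ 2) * (2 * r * sin u))| <= 4 * ((1 - r) * `|u|).
  rewrite normrN !normrM (ger0_norm num0) (ger0_norm r0) ger0_norm//.
  have h1 : 2 * r * `|sin u| <= 2 * `|u|.
    apply: ler_pM => //; [by rewrite mulr_ge0|clear - r1; lra|exact: norm_sin_le].
  have -> : 4 * ((1 - r) * `|u|) = 2 * (1 - r) * (2 * `|u|) by ring.
  by apply: ler_pM => //; rewrite !mulr_ge0.
rewrite normrM normfV [`|den ^+ 2|]ger0_norm ?sqr_ge0//.
apply: (@le_trans _ _ (4 * ((1 - r) * `|u|) / (k * q) ^+ 2)).
  apply: ler_pM => //; first by rewrite invr_ge0 sqr_ge0.
  have kq0 : 0 < k * q by rewrite mulr_gt0.
  rewrite lef_pV2 ?posrE ?exprn_gt0// lerXn2r ?nnegrE//; exact: ltW.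
have -> : 4 * ((1 - r) * `|u|) / (k * q) ^+ 2 =
    4 / k ^+ 2 * ((1 - r) * `|u|) / q ^+ 2.
  by field; rewrite !gt_eqF.
rewrite ler_wpM2r ?invr_ge0 ?sqr_ge0// ler_wpM2r ?mulr_ge0//; first exact: ltW.
by rewrite /K lerDl ltW.
Qed.

(** Within some distance [d] of [theta0] this is differentiability; beyond [d], the constant bound
    [M'] on the remainder is at most [M' / d ^+ 3] times the cube of the distance. *)
Let increment_le Phi theta0 (c M e : R) : 0 < e ->
  is_derive theta0 1 Phi c -> (forall t, `|Phi t| <= M) ->
  - pi < theta0 < pi ->
  exists2 B : R, 0 <= B & forall t, - pi <= t <= pi ->
    `|Phi t - Phi theta0 - c * (t - theta0)| <=
      e * `|t - theta0| + B * `|t - theta0| ^+ 3.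
Proof.
move=> e0 [dPhi PhiE] PhiM /andP[t1 t2].
have M0 : 0 <= M by exact: le_trans (normr_ge0 _) (PhiM 0).
have [d d0 Hd] : exists2 d : R, 0 < d & forall t, `|t - theta0| < d ->
    `|Phi t - Phi theta0 - c * (t - theta0)| <= e * `|t - theta0|.
  have /cvgrPdist_le /(_ e e0) : h^-1 *: (Phi (h *: 1 + theta0) - Phi theta0)
      @[h --> 0^'] --> c by rewrite -PhiE; exact: dPhi.
  rewrite /dnbhs /within /= => /nbhs_ballP[d /= d0 Hd].
  exists d => // t td.
  have [->|tne] := eqVneq t theta0; first by rewrite !subrr mulr0 subrr normr0 mulr0.
  have h0 : t - theta0 != 0 by rewrite subr_eq0.
  have := Hd (t - theta0); rewrite /ball/= sub0r normrN => /(_ td h0).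
  rewrite -[_ *: _]/(_ * _) -[(t - theta0) *: 1]/(_ * 1) mulr1 subrK => H.
  have -> : Phi t - Phi theta0 - c * (t - theta0) =
      - ((c - (t - theta0)^-1 * (Phi t - Phi theta0)) * (t - theta0)).
    by field.
  by rewrite normrN normrM ler_wpM2r.
pose M' := 2 * M + `|c| * (2 * pi).
have pi0 := pi_gt0 R.
have M'0 : 0 <= M' by rewrite addr_ge0 ?mulr_ge0// ltW.
exists (M' / d ^+ 3); first by rewrite divr_ge0// exprn_ge0// ltW.
move=> t /andP[tp1 tp2]; have [td|td] := ltP `|t - theta0| d.
  by apply: le_trans (Hd t td) _; rewrite lerDl mulr_ge0 ?exprn_ge0// divr_ge0// exprn_ge0// ltW.
apply: (@le_trans _ _ M').
  have h1 : `|t - theta0| <= 2 * pi by rewrite ler_norml; apply/andP; split; lra.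
  have h2 := ler_normB (Phi t - Phi theta0) (c * (t - theta0)).
  have h3 := ler_normB (Phi t) (Phi theta0).
  have h4 := PhiM t; have h5 := PhiM theta0.
  have h6 : `|c * (t - theta0)| <= `|c| * (2 * pi) by rewrite normrM ler_wpM2l.
  by rewrite /M'; lra.
apply: (@le_trans _ _ (M' / d ^+ 3 * `|t - theta0| ^+ 3)); last first.
  by rewrite lerDr mulr_ge0// ltW.
rewrite mulrAC ler_pdivlMr ?exprn_gt0// ler_wpM2l//.
by rewrite lerXn2r ?nnegrE// ltW.
Qed.

Lemma poisson_stieltjes_cvg Phi theta0 (c M C : R) :
  - pi < theta0 < pi -> Phi (- pi) = Phi pi -> (forall t, `|Phi t| <= M) ->
  is_derive theta0 1 Phi c -> 0 <= C ->
  forall e : R, 0 < e -> exists2 d : R, 0 < d & forall r theta I,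
    0 <= r < 1 -> 1 - r < d -> `|theta - theta0| <= C * (1 - r) ->
    is_RS_integral (fun t => poisson_kernel r (theta - t)) Phi (- pi) pi I ->
    `|(2 * pi)^-1 * I - c| <= e.
Proof.
move=> th0 Phi_pi PhiM dPhi C0 e e0; have pi0 := pi_gt0 R.
have [K [d1 [K0 d1_gt0 HK]]] := poisson_reflect_derive_le th0 C0.
(* [C] accounts for the distance from [theta] to [theta0], the added 1 for a mesh below [1 - r]. *)
pose C1 := C + 1.
have C1_ge1 : 1 <= C1 by rewrite /C1 lerDr.
have C1_gt0 : 0 < C1 by exact: lt_le_trans ltr01 C1_ge1.
pose e1 := e / (K * (2 * C1)).
have e1_gt0 : 0 < e1 by rewrite divr_gt0// !mulr_gt0.
have [B B0 HB] := increment_le e1_gt0 dPhi PhiM th0.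
pose A2 := K * B * (16 * C1 ^+ 4).
have A2_ge0 : 0 <= A2 by rewrite !mulr_ge0 ?exprn_ge0// ltW.
(* The error terms proportional to [1 - r]: the distance from the sum to [I], the boundary term and
   the cubic term. *)
pose X := 1 + 2 * pi * `|c| * K + A2 * (2 * pi).
have X0 : 0 < X.
  have h1 : 0 <= 2 * pi * `|c| * K by rewrite !mulr_ge0// ltW.
  have h2 : 0 <= A2 * (2 * pi) by rewrite !mulr_ge0// ltW.
  by rewrite /X; lra.
exists (Num.min d1 (pi * e / X)); first by rewrite lt_min d1_gt0 !divr_gt0// mulr_gt0.
move=> r theta I r01; rewrite lt_min => /andP[rd1 rd2] thC intI.
have [bdry [dg Hdg]] := HK r theta r01 rd1 thC.
set p := 1 - r in rd2 thC bdry Hdg.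
have p0 : 0 < p by move: r01 => /andP[_]; rewrite /p; lra.
pose g t := poisson_kernel r (theta - t).
pose G t := - poisson_antiderivative r (theta - t).
have dG x : is_derive x 1 G (g x).
  have dQ u := is_derive_poisson_antiderivative u r01.
  have H := is_deriveN (is_derive_reflect theta x dQ).
  by apply: (is_derive_eq H); rewrite opprK.
have [dl dl0 Hdl] := intI p p0.
have mpi : - pi < pi :> R by rewrite gtrN.
have eta0 : 0 < Num.min dl p by rewrite lt_min dl0.
have [N [t [tau [tN0 tN part sumG]]]] := uniform_partition_MVT mpi eta0 dG.
pose F s := Phi s - Phi theta0 - c * (s - theta0).
pose A1 := K * e1 * (2 * C1).
have A1E : A1 = e by rewrite /A1 /e1; field; apply/andP; split; rewrite gt_eqF.
(* The first term is a primitive of a multiple of the Poisson kernel of the half-plane. As [atan]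
   has range of length [pi], it increases by at most [e * pi], however small [p] is. *)
pose W s := A1 * atan ((s - theta) / p) + A2 * p * s.
have dW x : is_derive x 1 W
    (A1 * (p / (p ^+ 2 + `|theta - x| ^+ 2)) + A2 * p).
  have d1' : is_derive x 1 (fun s : R => (s - theta) / p) (p^-1).
    have H := is_derive_div (is_deriveB (is_derive_id x 1)
      (is_derive_cst theta x 1)) (is_derive_cst p x 1) (lt0r_neq0 p0).
    by apply: (is_derive_eq H); rewrite /cst; field; rewrite gt_eqF.
  have d2' := @is_derive1_comp R atan (fun s => (s - theta) / p) x _ _
    (is_derive1_atan _) d1'.
  have H := is_deriveD (is_deriveZ A1 d2') (is_deriveZ (A2 * p) (is_derive_id x 1)).
  have q0 : 0 < p ^+ 2 + (theta - x) ^+ 2.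
    by have := sqr_ge0 (theta - x); have := exprn_gt0 2 p0; clear; lra.
  have E : (1 + ((x - theta) / p) ^+ 2)^-1 * p^-1 =
      p / (p ^+ 2 + (theta - x) ^+ 2).
    have -> : 1 + ((x - theta) / p) ^+ 2 = (p ^+ 2 + (theta - x) ^+ 2) / p ^+ 2.
      by field; rewrite gt_eqF.
    by field; rewrite !gt_eqF.
  apply: (is_derive_eq H).
  by rewrite /GRing.scale/= mulr1 real_normK ?num_real// E.
have cell x y : - pi <= x -> x <= y -> y <= pi -> y - x < p -> forall z, x <= z <= y ->
    `|F z * (g y - g x)| <= W y - W x.
  move=> x1 xy y1 xyp z /andP[xz zy].
  have spi s : x <= s -> s <= y -> - pi <= s <= pi.
    by move=> xs sy; rewrite (le_trans x1 xs) (le_trans sy y1).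
  apply: (@MVT_dominated R g dg W
      (fun s => A1 * (p / (p ^+ 2 + `|theta - s| ^+ 2)) + A2 * p) _ _ _ xy _
      (fun s _ => dW s)).
    by move=> s; rewrite in_itv/= => /andP[xs sy]; have [] := Hdg s (spi s xs sy).
  move=> s; rewrite in_itv/= => /andP[xs sy].
  have [_ dgs] := Hdg s (spi s xs sy).
  have Fz := HB z (spi z xz zy).
  have zth : `|z - theta0| <= `|theta - s| + C1 * p.
    have h1 : `|z - s| <= p.
      rewrite ler_norml; move: xyp xz zy xs sy; clear => *.
      by apply/andP; split; lra.
    have h2 := ler_distD s z theta0.
    have h3 := ler_distD theta s theta0; rewrite (distrC s theta) in h3.
    rewrite /C1; move: thC h1 h2 h3; clear; lra.
  rewrite -[A2 * p]/(K * B * (16 * C1 ^+ 4) * p).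
  apply: (kernel_times_increment_le p0 (normr_ge0 _) (ltW e1_gt0) B0 C1_ge1
    (ltW K0) (normr_ge0 _) (normr_ge0 _) _ dgs).
  apply: le_trans Fz _; apply: lerD.
    by rewrite ler_wpM2l// ltW.
  rewrite ler_wpM2l// lerXn2r ?nnegrE//.
  by rewrite addr_ge0// mulr_ge0// ltW.
have sumF : `|\sum_(0 <= k < N) g (tau k) * (F (t k.+1) - F (t k)) -
    (g pi * F pi - g (- pi) * F (- pi) - (0 - 0))| <= W pi - W (- pi).
  apply: (@RS_sum_by_parts R F g (cst 0) W (- pi) pi p) tN0 tN _.
    move=> x y x1 xy y1 xyp; rewrite /cst subrr !subr0.
    by split; apply: cell; rewrite ?lexx ?xy.
  move=> k kN; have [h1 + h3] := part k kN.
  by rewrite lt_min => /andP[_ h2]; split.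
(* By periodicity the boundary term becomes [g pi] times the increment of [F], and [g pi] is at most
   [K * p]. *)
have gpi : g (- pi) = g pi.
  rewrite /g -(poisson_kernel_2pi r (theta - pi)); congr poisson_kernel; ring.
have Gpi : G pi - G (- pi) = 2 * pi.
  rewrite /G (_ : theta - - pi = theta - pi + 2 * pi); last by ring.
  rewrite poisson_antiderivative_2pi; ring.
have Fpi : F pi - F (- pi) = - (2 * pi * c) by rewrite /F Phi_pi; ring.
(* The choice of tags makes the linear part contribute exactly [c * (2 * pi)]. *)
have sumPhi : \sum_(0 <= k < N) g (tau k) * (Phi (t k.+1) - Phi (t k)) =
    \sum_(0 <= k < N) g (tau k) * (F (t k.+1) - F (t k)) + c * (2 * pi).
  rewrite -Gpi -sumG mulr_sumr -big_split/=; apply: eq_bigr => k _.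
  by rewrite /F; ring.
have Wpi : W pi - W (- pi) <= e * pi + A2 * p * (2 * pi).
  have h1 := atan_ltpi2 ((pi - theta) / p).
  have h2 := atan_gtNpi2 ((- pi - theta) / p).
  rewrite /W A1E.
  have : e * (atan ((pi - theta) / p) - atan ((- pi - theta) / p)) <= e * pi.
    by rewrite ler_wpM2l ?(ltW e0)//; clear - h1 h2; lra.
  clear; lra.
have intS : `|\sum_(0 <= k < N) g (tau k) * (Phi (t k.+1) - Phi (t k)) - I| < p.
  apply: Hdl => // k kN; have [h1 + h3] := part k kN.
  by rewrite lt_min => /andP[h2 _]; split.
rewrite gpi -mulrBr Fpi in sumF; rewrite sumPhi in intS.
move: sumF intS; set S := \sum_(_ <= _ < _) _ => sumF intS.
have gc : `|g pi * - (2 * pi * c)| <= K * p * (2 * pi * `|c|).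
  have gpi0 : 0 <= g pi.
    rewrite /g /poisson_kernel divr_ge0//; last exact: ltW (denom_gt0 _ r01).
    by move: r01; clear => /andP[]; nra.
  rewrite normrM normrN (ger0_norm gpi0) !normrM (ger0_norm (pi_ge0 R)) normr_nat.
  by rewrite ler_wpM2r// !mulr_ge0// ltW.
have pX : p * X < pi * e by rewrite -ltr_pdivlMr.
have I2 : `|I - 2 * pi * c| <= 2 * pi * e.
  move: sumF intS gc Wpi pX; rewrite /X !ler_norml !ltr_norml.
  clear.
  by move=> /andP[? ?] /andP[? ?] /andP[? ?] ? ?; apply/andP; split; lra.
have -> : (2 * pi)^-1 * I - c = (2 * pi)^-1 * (I - 2 * pi * c).
  by rewrite mulrBr mulKf// mulf_neq0// gt_eqF.
rewrite normrM gtr0_norm ?invr_gt0 ?mulr_gt0// mulrC ler_pdivrMr ?mulr_gt0//.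
by rewrite [leRHS]mulrC.
Qed.
End FatouTheorem.

(** * Polar coordinates and nontangential approach *)

Section Polar.
Context {R : realType}.
Implicit Types (z zeta : R[i]) (t tau : R) (gamma : R -> R[i]).
Local Open Scope complex_scope.
Import ComplexField.Normc.

Lemma sqr_normc z : normc z ^+ 2 = complex.Re z ^+ 2 + complex.Im z ^+ 2.
Proof. by case: z => x y; rewrite /normc sqr_sqrtr// addr_ge0// sqr_ge0. Qed.

Lemma normc_ge0 z : 0 <= normc z.
Proof. by case: z => x y; rewrite /normc sqrtr_ge0. Qed.

Lemma normc_expi t : normc (expi t) = 1.
Proof. by rewrite /normc /expi cos2Dsin2 sqrtr1. Qed.

Lemma polar_coordinates z : exists t : R,
  - pi < t <= pi /\ z = (normc z)%:C * expi t.
Proof.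
case: z => x y.
have [/eq0_normc ->|z0] := eqVneq (normc (x +i* y)) 0.
  exists pi; rewrite lexx andbT gtrN ?pi_gt0//; split => //.
  by rewrite /normc/= expr0n addr0 sqrtr0 mul0r.
set r := normc _ in z0 *.
have r0 : 0 < r by rewrite lt0r z0 normc_ge0.
have rE : r ^+ 2 = x ^+ 2 + y ^+ 2 by rewrite sqr_normc.
have xr : -1 <= x / r <= 1.
  by rewrite ler_pdivlMr// ler_pdivrMr//; apply/andP; split; nra.
have sinE : sin (acos (x / r)) = `|y| / r.
  have -> : `|y| / r = Num.sqrt ((y / r) ^+ 2).
    by rewrite sqrtr_sqr normrM normfV (gtr0_norm r0).
  rewrite sin_acos//; congr Num.sqrt.
  by rewrite !expr_div_n rE; field; rewrite -rE expf_neq0.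
have main t : cos t = x / r -> sin t = y / r -> x +i* y = r%:C * expi t.
  move=> ct st; rewrite /expi ct st; apply/eqP; rewrite eq_complex/=.
  by rewrite !mul0r subr0 addr0 !(mulrC r) !divfK// !eqxx.
have [y0|y0] := leP 0 y.
  exists (acos (x / r)); split.
    rewrite acos_lepi// andbT (lt_le_trans _ (acos_ge0 xr))//.
    by rewrite oppr_lt0 pi_gt0.
  by apply: main; rewrite ?acosK// sinE ger0_norm.
exists (- acos (x / r)); split; last first.
  by apply: main; rewrite ?cosN ?acosK// sinN sinE ltr0_norm// mulNr opprK.
(* Strictness, due to [y < 0], excludes the angle [- pi]. *)
have xr' : -1 < x / r <= 1.
  rewrite (proj2 (andP xr)) andbT ltr_pdivlMr// mulN1r ltNge; apply/negP => xr'.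
  have : 0 < y ^+ 2 by rewrite exprn_even_gt0//= lt_eqF.
  nra.
apply/andP; split; first by rewrite ltrN2 acos_ltpi.
by rewrite (le_trans _ (pi_ge0 R))// oppr_le0 acos_ge0.
Qed.

Lemma cargP z : - pi < carg z <= pi /\ z = (normc z)%:C * expi (carg z).
Proof.
rewrite /carg; case: xgetP => [t _ //|/= none].
by have [t /none] := polar_coordinates z.
Qed.

(** The law of cosines, arranged as a sum of a radial and an angular term, both nonnegative. *)
Lemma sqr_normc_subr z tau : normc (z - expi tau) ^+ 2 =
  (1 - normc z) ^+ 2 + 2 * normc z * (1 - cos (carg z - tau)).
Proof.
have [_ zE] := cargP z.
rewrite {1}zE sqr_normc /expi/= !mul0r subr0 addr0 cosB.
have h1 := cos2Dsin2 tau; have h2 := cos2Dsin2 (carg z).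
move: (cos tau) (sin tau) (cos (carg z)) (sin (carg z)) (normc z) h1 h2.
move=> c s c' s' r h1 h2.
have -> : (r * c' - c) ^+ 2 + (r * s' - s) ^+ 2 =
  r ^+ 2 * (c' ^+ 2 + s' ^+ 2) - 2 * r * (c' * c + s' * s) + (c ^+ 2 + s ^+ 2).
  by ring.
by rewrite h1 h2; ring.
Qed.

(** Two angles in []-pi, pi]] differ by less than [2 * pi]; there [one_sub_cos_ge] forces the
    difference to vanish once its cosine is 1. *)
Lemma carg_expi t : - pi < t <= pi -> carg (expi t) = t.
Proof.
move=> /andP[t1 t2]; have [/andP[c1 c2] _] := cargP (expi t).
have [//|ne] := eqVneq (carg (expi t)) t.
have w0 : 0 < `|carg (expi t) - t| < 2 * pi.
  by rewrite normr_gt0 subr_eq0 ne ltr_norml; apply/andP; split; lra.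
have [k k0 /(_ _ (lexx _))] := one_sub_cos_ge w0.
have := sqr_normc_subr (expi t) t.
have n0 : normc (0 : R[i]) = 0 by rewrite /normc/= expr0n addr0 sqrtr0.
rewrite normc_expi !subrr n0 !expr0n/= mulr1 add0r => /esym/eqP.
rewrite mulf_eq0 pnatr_eq0/= => /eqP ->.
have : 0 < (carg (expi t) - t) ^+ 2 by rewrite exprn_even_gt0//= subr_eq0.
nra.
Qed.

(** The jump of [carg] is harmless: [carg z - tau] is at most [pi + |tau|] in absolute value, which
    is less than [2 * pi], so the angular term of [sqr_normc_subr] controls it quadratically. *)
Lemma carg_sub_le tau : - pi < tau < pi -> exists2 C : R, 0 < C & forall z,
  normc (z - expi tau) <= 2^-1 ->
  [/\ `|carg z - tau| <= C * normc (z - expi tau),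
      1 - normc z <= normc (z - expi tau) & 2^-1 <= normc z].
Proof.
move=> /andP[t1 t2].
have W0 : 0 < pi + `|tau| < 2 * pi.
  have : `|tau| < pi by rewrite ltr_norml t1.
  have := normr_ge0 tau; have := pi_gt0 R.
  by move=> ? ? ?; apply/andP; split; lra.
have [k k0 Hk] := one_sub_cos_ge W0.
(* The square of this constant exceeds [k^-1], so no square root is needed. *)
exists (k^-1 + 1); first by rewrite addr_gt0// invr_gt0.
move=> z zt; have zE := sqr_normc_subr z tau.
have [/andP[c1 c2] _] := cargP z.
have n0 := normc_ge0 (z - expi tau).
have r0 := normc_ge0 z.
have cos1 := cos_le1 (carg z - tau).
have H1 : 1 - normc z <= normc (z - expi tau).
  have [neg|pos] := leP (1 - normc z) 0; first exact: le_trans neg n0.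
  rewrite -(@ler_pXn2r _ 2%N)// ?nnegrE// ?(ltW pos)// zE lerDl.
  by rewrite !mulr_ge0// subr_ge0.
have H2 : 2^-1 <= normc z by lra.
split => //.
have kw : k * (carg z - tau) ^+ 2 <= normc (z - expi tau) ^+ 2.
  have := Hk (carg z - tau).
  have : `|carg z - tau| <= pi + `|tau|.
    apply: le_trans (ler_normB _ _) _; rewrite lerD2r ler_norml.
    by apply/andP; split; lra.
  move=> wW /(_ wW) H; rewrite zE.
  have h1 : 1 - cos (carg z - tau) <= 2 * normc z * (1 - cos (carg z - tau)).
    by rewrite ler_peMl; lra.
  have := sqr_ge0 (1 - normc z); lra.
have ki0 : 0 < k^-1 by rewrite invr_gt0.
rewrite -(@ler_pXn2r _ 2%N)// ?nnegrE ?mulr_ge0//; last by lra.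
rewrite real_normK ?num_real// exprMn.
have : (carg z - tau) ^+ 2 <= k^-1 * normc (z - expi tau) ^+ 2.
  by rewrite mulrC ler_pdivlMr// mulrC.
have := sqr_ge0 (normc (z - expi tau)).
nra.
Qed.

(** The ray from the vertex through [gamma s] is still in the disc at distance [rho / 2], which
    forces [cos (phi - tau) < - (rho / 4)]. Closer to the vertex, the squared modulus then drops
    below 1 at a linear rate. *)
Lemma nontangential_Stolz tau gamma : nontangential (expi tau) gamma ->
  exists C d : R, [/\ 0 < C, 0 < d & forall s : R, 0 <= s < 1 ->
    normc (gamma s - expi tau) < d ->
    normc (gamma s - expi tau) <= C * (1 - normc (gamma s))].
Proof.
move=> [al [be [rho [albe rho0 inside path]]]].
exists (8 / rho), (rho / 4); split; [by rewrite divr_gt0|by rewrite divr_gt0|].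
move=> s s01 sd.
have dir s' phi : 0 < s' -> normc (expi tau + s'%:C * expi phi - expi tau) = s'.
  move=> s'0; rewrite addrAC subrr add0r.
  apply/eqP; rewrite -(@eqrXn2 _ 2%N)// ?normc_ge0// ?(ltW s'0)// sqr_normc.
  rewrite /expi/= !mul0r subr0 addr0 !exprMn -mulrDr cos2Dsin2 mulr1.
  exact: eqxx.
have dirN s' phi : normc (expi tau + s'%:C * expi phi) ^+ 2 =
    1 + 2 * s' * cos (phi - tau) + s' ^+ 2.
  rewrite sqr_normc /expi/= !mul0r subr0 addr0 cosB.
  have h1 := cos2Dsin2 tau; have h2 := cos2Dsin2 phi.
  have -> : (cos tau + s' * cos phi) ^+ 2 + (sin tau + s' * sin phi) ^+ 2 =
    (cos tau ^+ 2 + sin tau ^+ 2) +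
    2 * s' * (cos phi * cos tau + sin phi * sin tau) +
    s' ^+ 2 * (cos phi ^+ 2 + sin phi ^+ 2) by ring.
  by rewrite h1 h2 mulr1.
have [s0 [phi [s00 phiab gE]]] := path s s01 (ltac:(lra)).
rewrite gE (dir _ _ s00) in sd *.
have q : cos (phi - tau) < - (rho / 4).
  have rho2 : 0 < rho / 2 by rewrite divr_gt0.
  have : unit_disc (expi tau + (rho / 2)%:C * expi phi).
    apply: inside; first by exists (rho / 2), phi.
    by rewrite dir//; lra.
  rewrite /unit_disc/= => n1.
  have := dirN (rho / 2) phi.
  have := normc_ge0 (expi tau + (rho / 2)%:C * expi phi).
  move: n1; set n := normc _ => n1 n0 nE.
  have : n ^+ 2 < 1 by rewrite expr_lt1.
  rewrite nE; nra.
have := dirN s0 phi; have := normc_ge0 (expi tau + s0%:C * expi phi).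
set n := normc _ => n0 nE.
rewrite mulrAC ler_pdivlMr//.
(* Here [s0 < rho / 4] absorbs the quadratic term. The constant 8 arises from
   [1 - n ^+ 2 <= 2 * (1 - n)]. *)
have n1 : n ^+ 2 <= 1 - s0 * rho / 4 by rewrite nE; nra.
nra.
Qed.

End Polar.

(** * Existence of the Poisson-Stieltjes integral *)

Section PoissonStieltjesIntegrable.
Context {R : realType}.
Implicit Types (Phi : R -> R) (r theta M : R).

(** For fixed [r] the kernel has a continuous bounded derivative, its denominator being at least
    [(1 - r) ^+ 2]; differentiability almost everywhere gives continuity of [Phi] almost
    everywhere. *)
Lemma RS_integrable_poisson Phi r theta M : 0 <= r < 1 ->
  (forall t, `|Phi t| <= M) ->
  (@lebesgue_measure R).-negligible [set x | ~ derivable Phi x 1] ->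
  RS_integrable (fun t => poisson_kernel r (theta - t)) Phi (- pi) pi.
Proof.
move=> r01 PhiM neg; have pi0 := pi_gt0 R.
have /andP[r0 r1] := r01.
pose D u : R := 1 - 2 * r * cos u + r ^+ 2.
pose dP u : R := - ((1 - r ^+ 2) * (2 * r * sin u)) / D u ^+ 2.
have Dge u : (1 - r) ^+ 2 <= D u.
  by rewrite /D; have := cos_le1 u; nra.
have p0 : 0 < (1 - r) ^+ 2 by rewrite exprn_gt0// subr_gt0.
have cdP : continuous dP.
  move=> u; have cs := @continuous_sin R u; have cc := @continuous_cos R u.
  have cD : D x @[x --> u] --> D u.
    apply: cvgD; last exact: cvg_cst.
    by apply: cvgB; [exact: cvg_cst|apply: cvgM => //; exact: cvg_cst].
  apply: cvgM.
    apply: cvgN; apply: cvgM; first exact: cvg_cst.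
    by apply: cvgM => //; exact: cvg_cst.
  apply: cvgV; last by apply: cvgM.
  by rewrite expf_neq0// gt_eqF// (lt_le_trans p0).
apply: (@RS_integrable_of_continuous_ae R Phi _ (fun x => - dP (theta - x)) _ _
  (2 / ((1 - r) ^+ 2) ^+ 2) M) => //.
- lra.
- by move=> x; apply: is_derive_reflect => u; exact: is_derive_poisson_kernel.
- move=> x; apply: cvgN.
  apply: (@continuous_comp _ _ _ (fun y => theta - y) dP); last exact: cdP.
  by apply: cvgB; [exact: cvg_cst|exact: cvg_id].
- move=> x; rewrite normrN /dP normrM normfV [`|D _ ^+ 2|]ger0_norm ?sqr_ge0//.
  have D0 u : 0 < D u by exact: lt_le_trans p0 (Dge u).
  apply: ler_pM => //; first by rewrite invr_ge0 sqr_ge0.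
    have r2 : 0 <= 1 - r ^+ 2 by nra.
    rewrite normrN !normrM (ger0_norm r0) (ger0_norm r2) normr_nat -mulrA.
    have sin1 : `|sin (theta - x)| <= 1 by rewrite ler_norml sin_geN1 sin_le1.
    have rs0 : 0 <= r * `|sin (theta - x)| by rewrite mulr_ge0.
    have rs1 : r * `|sin (theta - x)| <= 1 by rewrite mulr_ile1// ltW.
    have h1 : 2 * (r * `|sin (theta - x)|) <= 2 by lra.
    have h2 : 0 <= 2 * (r * `|sin (theta - x)|) by lra.
    rewrite -[leRHS]mul1r; apply: ler_pM => //.
    by have := sqr_ge0 r; lra.
  rewrite lef_pV2 ?posrE; [|exact: exprn_gt0|exact: exprn_gt0].
  apply: lerXn2r; rewrite ?nnegrE; [exact: ltW|exact: ltW|exact: Dge].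
- apply: negligibleS neg => x ncx dx; apply: ncx.
  by apply: differentiable_continuous; exact/derivable1_diffP.
Qed.

End PoissonStieltjesIntegrable.

(** * Limits along nontangential paths *)

Section NontangentialLimit.
Context {R : realType}.
Implicit Types (Phi : R -> R) (t M : R) (gamma : R -> R[i]).
Local Open Scope complex_scope.
Import ComplexField.Normc.

Lemma path_to_cvg zeta gamma : path_to zeta gamma -> forall e : R, 0 < e ->
  \forall s \near 1^'-, normc (gamma s - zeta) < e.
Proof.
move=> [cgamma _ gamma1] e e0.
(* The norm of [R[i]^o] takes values in [R[i]], so the radius is embedded as [e%:C]. *)
have [_ _ /cvgrPdist_lt /(_ e%:C)] := (continuous_within_itvP (gamma : R -> R[i]^o) ltr01).1 cgamma.
rewrite ltcR => /(_ e0); apply: filterS => s.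
rewrite gamma1 distrC.
by rewrite -[`|_|]/((normc (gamma s - zeta))%:C) ltcR.
Qed.

(** Chaining [carg_sub_le] with [nontangential_Stolz] bounds the angular deviation by [C2 * C] times
    [1 - normc (gamma s)], as [poisson_stieltjes_cvg] requires. *)
Lemma poisson_stieltjes_nontangential Phi tau M gamma :
  - pi < tau < pi -> Phi (- pi) = Phi pi -> (forall t, `|Phi t| <= M) ->
  (forall z, unit_disc z -> RS_integrable (poisson_at z) Phi (- pi) pi) ->
  derivable Phi tau 1 ->
  path_to (expi tau) gamma -> nontangential (expi tau) gamma ->
  poisson_stieltjes Phi (gamma s) @[s --> (1 : R)^'-] --> derive1 Phi tau.
Proof.
move=> tau_pi Phi_pi PhiM PhiI dPhi gpath gnt.
have [C [d [C0 d0 Stolz]]] := nontangential_Stolz gnt.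
have [C2 C20 argle] := carg_sub_le tau_pi.
have dPhi' : is_derive tau 1 Phi (derive1 Phi tau).
  by rewrite derive1E; exact/derivableP.
have CC0 : 0 <= C2 * C by rewrite mulr_ge0// ltW.
apply/cvgrPdist_le => e e0.
have [d' d'0 H] := poisson_stieltjes_cvg tau_pi Phi_pi PhiM dPhi' CC0 e0.
have m0 : 0 < Num.min d (Num.min 2^-1 d') by rewrite !lt_min d0 d'0 invr_gt0 ltr0n.
near=> s.
have s01 : 0 <= s < 1.
  apply/andP; split; last by near: s; exact: nbhs_left_lt.
  by apply/ltW; near: s; exact: nbhs_left_gt.
have : normc (gamma s - expi tau) < Num.min d (Num.min 2^-1 d').
  by near: s; exact: path_to_cvg gpath _ m0.
rewrite !lt_min => /andP[sd /andP[s2 sd']].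
have [_ /(_ s s01) gdisc _] := gpath.
have [arg1 arg2 _] := argle _ (ltW s2).
rewrite distrC; apply: (H (normc (gamma s)) (carg (gamma s))).
- by rewrite normc_ge0.
- exact: le_lt_trans arg2 sd'.
- by apply: (le_trans arg1); rewrite -mulrA ler_wpM2l ?(ltW C20)//; exact: Stolz.
(* Integrability ensures that [RS_integral] is a genuine integral and not the default 0. *)
- have [I intI] := PhiI _ gdisc.
  by rewrite /RS_integral; case: xgetP => [J _ //|/(_ I)].
Unshelve. all: end_near. Qed.

End NontangentialLimit.

(** * The boundary limit almost everywhere on the circle *)

Unset Implicit Arguments.

Theorem corollary3 (R : realType) (Phi : R -> R)
    (Phi_periodic : periodic Phi (2 * pi))
    (Phi_bounded : bounded_fun Phi)
    (Phi_CBV : CBV Phi) :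
  (forall z : R[i], unit_disc z ->
     RS_integrable (poisson_at z) Phi (- pi) pi) /\
  ae_circle (fun zeta : R[i] =>
    derivable Phi (carg zeta) 1 /\
    forall gamma : R -> R[i],
      path_to zeta gamma -> nontangential zeta gamma ->
      poisson_stieltjes Phi (gamma s) @[s --> (1 : R)^'-]
        --> derive1 Phi (carg zeta)).
Proof.
have neg := CBV_derivable_ae Phi_CBV.
have [M PhiM] : exists M, forall t, `|Phi t| <= M.
  have [M [_ HM]] := Phi_bounded.
  by exists (M + 1) => t; apply: HM => //; rewrite ltrDl.
have PhiI z : unit_disc z -> RS_integrable (poisson_at z) Phi (- pi) pi.
  by move=> z1; apply: RS_integrable_poisson PhiM neg; rewrite normc_ge0.
have Phi_pi : Phi (- pi) = Phi pi.
  by rewrite -Phi_periodic; congr Phi; ring.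
split => //.
(* The angle [pi], where [carg] jumps, is discarded as a null set. *)
have neg' : (@lebesgue_measure R).-negligible
    ([set x | ~ derivable Phi x 1] `|` [set pi]).
  apply: negligibleU => //; apply/negligibleP => //.
  exact: lebesgue_measure_set1.
apply: negligibleS neg' => t /= nt; apply: contrapT => /not_orP[dt tpi].
apply: nt => /andP[t1 t2].
have tau_pi : - pi < t < pi by rewrite t1 lt_neqAle t2 andbT; exact/eqP.
rewrite carg_expi ?t1//; split; first exact: contrapT.
move=> gamma gpath gnt.
by apply: (poisson_stieltjes_nontangential tau_pi Phi_pi PhiM PhiI) => //; exact: contrapT.
Qed.
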